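(* Let $\Omega\subset\mathbb{R}^2$ be a bounded open set that is convex and balanced. Then $$\kappa(\Omega)\le 2\sqrt{\lambda_1(\Omega)} .$$
   Context: $\Omega$ is balanced if it is invariant under $\mathbf{x}\mapsto-\mathbf{x}$. For a bounded open $\Omega\subset\mathbb{R}^d$ let $\widehat{\chi_\Omega}(\boldsymbol{\xi})=\int_\Omega e^{i\boldsymbol{\xi}\cdot\mathbf{x}}\,d\mathbf{x}$, and let $\mathcal{N}(\Omega)=\{\boldsymbol{\xi}\in\mathbb{R}^d:\widehat{\chi_\Omega}(\boldsymbol{\xi})=0\}$ be its real null set. Set $\kappa(\Omega)=\min\{|\boldsymbol{\xi}|:\boldsymbol{\xi}\in\mathcal{N}(\Omega)\}$, with $\kappa(\Omega)=\infty$ if $\mathcal{N}(\Omega)=\emptyset$. $\lambda_1(\Omega)$ is the first (lowest) eigenvalue of the Dirichlet Laplacian $-\Delta$ on $\Omega$. *)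

(* Defs.v *)
From HB Require Import structures.
From mathcomp Require Import all_boot all_order all_algebra.
From mathcomp Require Import all_classical all_reals all_analysis.
From mathcomp Require Import complex.
Set Implicit Arguments.
Unset Strict Implicit.
Unset Printing Implicit Defensive.
Import Order.TTheory GRing.Theory Num.Theory.
Import numFieldNormedType.Exports.
Local Open Scope classical_set_scope.
Local Open Scope ring_scope.

(* The plane is R * R.  Its library norm is the max norm, which gives the usual
   topology and the usual bounded sets; Euclidean lengths are written out. *)

Notation leb2 R := (@lebesgue_measure R \x @lebesgue_measure R)%E.

Section Plane.
Context {R : realType}.
Implicit Types (Omega : set (R * R)) (xi x : R * R).

Definition dot xi x : R := xi.1 * x.1 + xi.2 * x.2.

Definition eucl_norm xi : R := Num.sqrt (dot xi xi).

Definition balanced Omega := forall x, Omega x -> Omega (- x).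

(* The integral of exp (i xi.x) over Omega, by real and imaginary parts, since
   the library integrates real-valued functions. *)
Definition fourier_indic Omega xi : R[i] :=
  ((\int[leb2 R]_(x in Omega) cos (dot xi x)) +i*
   (\int[leb2 R]_(x in Omega) sin (dot xi x)))%C.

Definition null_set Omega : set (R * R) := [set xi | fourier_indic Omega xi = 0].

(* For bounded Omega the null set is closed, so the infimum is a minimum unless
   the null set is empty, in which case it is +oo. *)
Definition kappa Omega : \bar R :=
  ereal_inf [set (eucl_norm xi)%:E | xi in null_set Omega].


Definition smooth (phi : R * R -> R) :=
  forall (vs : seq (R * R)) x, differentiable (foldr (fun v f => 'D_v f) phi vs) x.

Definition test_function Omega (phi : R * R -> R) :=
  [/\ smooth phi,
      compact (closure [set x | phi x != 0]) &
      closure [set x | phi x != 0] `<=` Omega].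

Definition square_integrable Omega (f : R * R -> R) :=
  measurable_fun Omega f /\
  (leb2 R).-integrable Omega (EFin \o (fun x => f x ^+ 2)).

Definition weak_derivative Omega (v : R * R) (u g : R * R -> R) :=
  forall phi, test_function Omega phi ->
    \int[leb2 R]_(x in Omega) (u x * 'D_v phi x) =
    - \int[leb2 R]_(x in Omega) (g x * phi x).

(* u is in H^1(Omega) and has weak gradient (g1, g2). *)
Definition sobolev_H1 Omega (u g1 g2 : R * R -> R) :=
  [/\ square_integrable Omega u,
      square_integrable Omega g1 /\ square_integrable Omega g2,
      weak_derivative Omega (1, 0) u g1 &
      weak_derivative Omega (0, 1) u g2].

(* u is in H^1_0(Omega), the H^1-closure of the test functions. *)
Definition sobolev_H10 Omega (u g1 g2 : R * R -> R) :=
  sobolev_H1 Omega u g1 g2 /\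
  exists2 phi : nat -> R * R -> R, (forall n, test_function Omega (phi n)) &
    (fun n => \int[leb2 R]_(x in Omega)
       ((phi n x - u x) ^+ 2 + ('D_(1, 0) (phi n) x - g1 x) ^+ 2 +
        ('D_(0, 1) (phi n) x - g2 x) ^+ 2)) @ \oo --> (0 : R).

(* -Delta u = l u in the sense of distributions on Omega, for some nonzero u in
   H^1_0(Omega).  The operator is self-adjoint with real coefficients, so real l
   and u are enough. *)
Definition dirichlet_eigenvalue Omega (l : R) :=
  exists u g1 g2 : R * R -> R,
    [/\ sobolev_H10 Omega u g1 g2,
        ~ {ae leb2 R, forall x, Omega x -> u x = 0} &
        forall phi, test_function Omega phi ->
          \int[leb2 R]_(x in Omega)
            (g1 x * 'D_(1, 0) phi x + g2 x * 'D_(0, 1) phi x) =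
          l * \int[leb2 R]_(x in Omega) (u x * phi x)].

(* For bounded open Omega the eigenvalues are discrete, so the infimum is the
   lowest one; it is +oo when Omega is empty. *)
Definition lambda1 Omega : \bar R :=
  ereal_inf [set l%:E | l in dirichlet_eigenvalue Omega].

End Plane.

(* Main.v *)
(* Let N be the gauge of Omega, and among orthonormal frames (e1, e2) take one
   that maximizes N(e2)^2 - N(e1)^2.  Put p = N(e1), q = N(e2), X = p (e1 . x) and
   Y = q (e2 . x).  The first-order condition gives |m| <= 1 such that
   |X - m Y| < 1 and |Y + m X| < 1 on Omega, while Omega contains the square
   |X| + |Y| < 1.  Let T = pi sqrt (p^2 + q^2).

   kappa <= T: in the coordinates u = X + Y, v = X - Y, the body is the square
   |u|, |v| < 1, over which cos (pi u) + cos (pi v) has integral 0, together with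
   four caps, over each of which the integral is nonpositive.  Hence the Fourier
   transform is nonpositive at one of the two frequencies pi u, pi v, both of
   length T, and it vanishes on the segment joining this frequency to 0.

   T <= 2 sqrt lambda_1: a function vanishing off the strip |X - m Y| < 1 satisfies
   the one-dimensional Poincare inequality with constant (pi / 2)^2 in the
   direction e1 / p, and likewise for the other strip and e2 / q.  Adding the two,
   the Dirichlet energy is at least (pi / 2)^2 (p^2 + q^2) times the squared L^2
   norm. *)
Require Import Defs.
From mathcomp Require Import all_boot all_order all_algebra.
From mathcomp Require Import all_classical all_reals all_analysis.
From mathcomp Require Import measurable_realfun ring lra.
Import Order.TTheory GRing.Theory Num.Theory.
Import numFieldNormedType.Exports.
Local Open Scope classical_set_scope.
Local Open Scope ring_scope.
Set Implicit Arguments.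
Unset Strict Implicit.
Unset Printing Implicit Defensive.

(** * Integrals over the plane *)

(** The number m must be the same in both strips. Let a be a slope of N at e2 in direction e1, so
    that a x + q y <= N in frame coordinates. When the frame turns, maximality bounds the decrease
    of N(e1)^2 by that of N(e2)^2, which the support at e2 controls. Hence N has slope - q a / p at
    e1 in direction e2, although N need not be differentiable. In X and Y the two supports read Y +
    m X and X - m Y with m = a / p, and the first one, evaluated at e1 and - e1, gives |a| <= p.

    Because m is common, a quarter turn of the (u, v) plane exchanges the strips, so one cap
    estimate serves all four caps. The strips also cut off the corners where |u| and |v| both exceed
    1, which makes the caps disjoint. In the energy bound the tilt is harmless: it lies along the
    other frame vector, so each strip functional is still 1 on its direction e1 / p or e2 / q.

    The sum p^2 + q^2 has two origins that happen to match: it is the squared length of p e1 + q e2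
    and of p e1 - q e2, and p^2, q^2 are the weights that recombine the derivatives along e1 / p and
    e2 / q into the gradient. *)

Notation P2 R := (measurableTypeR R * measurableTypeR R)%type.

(** The measurable structure on the plane is the product one, so open sets must be reached through
    boxes. Balls of the max norm are products of intervals, and the countably many rational ones
    contained in [A] cover it. *)
Lemma open_measurable2 {R : realType} (A : set (R * R)) :
  open A -> measurable (A : set (P2 R)).
Proof.
move=> oA.
pose B (q : rat * rat * rat) : set (R * R) :=
  ball ((ratr q.1.1 : R), (ratr q.1.2 : R)) (ratr q.2 : R).
have -> : A = \bigcup_(q in [set q | B q `<=` A]) B q.
  apply/seteqP; split => [[x y] Axy|z [q Bq Bz]]; last exact: Bq.
  have /nbhs_ballP[e /= e0 eA] : nbhs (x, y) A by exact: open_nbhs_nbhs.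
  have [r /andP[r0 re]] : exists r : rat, (0 < (ratr r : R)) && ((ratr r : R) < e / 2).
    have [r] := @rat_in_itvoo R 0 (e / 2) ltac:(lra).
    by rewrite in_itv /= => rr; exists r.
  have [p] := @rat_in_itvoo R (x - ratr r) (x + ratr r) ltac:(lra).
  rewrite in_itv /= => /andP[p1 p2].
  have [q] := @rat_in_itvoo R (y - ratr r) (y + ratr r) ltac:(lra).
  rewrite in_itv /= => /andP[q1 q2].
  exists (p, q, r) => /=.
    move=> [x' y'] [/=]; rewrite /ball /= => h1 h2; apply: eA; split => /=; rewrite /ball /=.
      by move: h1; rewrite !ltr_norml => /andP[? ?]; apply/andP; split; lra.
    by move: h2; rewrite !ltr_norml => /andP[? ?]; apply/andP; split; lra.
  by split => /=; rewrite /ball /= ltr_norml; apply/andP; split; lra.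
rewrite bigcup_mkcond; apply: countable_bigcupT_measurable => [|q]; first exact: countableP.
case: ifPn => _ //.
have -> : B q = ball (ratr q.1.1 : R) (ratr q.2 : R) `*` ball (ratr q.1.2 : R) (ratr q.2 : R).
  by apply/seteqP; split.
by apply: measurableX; exact: measurable_ball.
Qed.

(** The right-hand side is a measure that agrees with Lebesgue measure on half-open intervals, and
    uniqueness concludes. A negative [s] exchanges the endpoints, hence the two cases. *)
Lemma lebesgue_measure_affine {R : realType} (s t : R)
    (A : set (measurableTypeR R)) : s != 0 -> measurable A ->
  lebesgue_measure A = (`|s|%:E * lebesgue_measure ((fun y => (s * y + t)%R) @^-1` A))%E.
Proof.
move=> s0 mA.
have ns : 0 <= `|s| by [].
pose f : measurableTypeR R -> measurableTypeR R := fun y => s * y + t.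
have mf : measurable_fun setT f.
  by apply: measurable_funD => //; apply: measurable_funM.
pose nu : {measure set (measurableTypeR R) -> \bar R} :=
  mscale (NngNum ns) (pushforward (@lebesgue_measure R) f).
rewrite (@lebesgue_measure_unique R (nu mf)) //.
move=> _ [[a b] /= ab <-]; rewrite /nu /mscale /= /pushforward.
rewrite lebesgue_measure_itv /=.
have [s_gt0|s_lt0] : 0 < s \/ s < 0 by apply/orP; rewrite orbC -neq_lt.
  have -> : f @^-1` `]a, b]%classic = `](a - t) / s, (b - t) / s]%classic.
    apply/seteqP; split => y /=; rewrite /f !in_itv /= ltr_pdivrMr // ler_pdivlMr // => /andP[? ?]; apply/andP; split; lra.
  rewrite lebesgue_measure_itv /= gtr0_norm // !lte_fin ltr_pM2r ?invr_gt0 // ltrD2r.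
  case: ifP => _; last by rewrite mule0.
  by rewrite -!EFinB -EFinM; congr EFin; field.
have -> : f @^-1` `]a, b]%classic = `[(b - t) / s, (a - t) / s[%classic.
  apply/seteqP; split => y /=; rewrite /f !in_itv /= ltr_ndivlMr // ler_ndivrMr // => /andP[? ?]; apply/andP; split; lra.
rewrite lebesgue_measure_itv /= ltr0_norm // !lte_fin ltr_nM2r ?invr_lt0 // ltrD2r.
case: ifP => _; last by rewrite mule0.
by rewrite -!EFinB -EFinM; congr EFin; field.
Qed.

Definition linmap {R : realType} (a b c d : R) (z : R * R) : R * R :=
  (a * z.1 + b * z.2, c * z.1 + d * z.2).

Lemma measurable_linmap {R : realType} (a b c d : R) :
  measurable_fun setT (linmap a b c d :
    P2 R -> P2 R).
Proof.
apply: measurable_fun_pair => /=;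
  by apply: measurable_funD; apply: measurable_funM.
Qed.

Lemma measurable_linmap_preimage {R : realType} (a b c d : R)
    (A : set (P2 R)) :
  measurable A ->
  measurable (linmap a b c d @^-1` A : set (P2 R)).
Proof. by move=> mA; have := @measurable_linmap R a b c d measurableT A mA; rewrite setTI. Qed.

Lemma leb2_lower {R : realType} (s t : R)
    (A : set (P2 R)) : s != 0 -> measurable A ->
  leb2 R A = (`|s|%:E * leb2 R ((fun z => (z.1, s * z.2 + t * z.1)%R) @^-1` A))%E.
Proof.
move=> s0 mA.
rewrite /= /product_measure1 /= -ge0_integralZl //; last first.
  apply: measurable_fun_xsection.
  rewrite -[_ @^-1` _]setTI.
  suff: measurable_fun setT (fun z : P2 R =>
     (z.1, s * z.2 + t * z.1)) by apply.
  apply: measurable_fun_pair => //=.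
  by apply: measurable_funD; apply: measurable_funM.
apply: eq_integral => x _ /=.
rewrite (lebesgue_measure_affine (t * x) s0); last exact: measurable_xsection.
by congr (_ * _)%E; congr lebesgue_measure.
Qed.

Lemma leb2_swap {R : realType} (A : set (P2 R)) :
  measurable A -> leb2 R A = (@lebesgue_measure R \x^ @lebesgue_measure R)%E A.
Proof.
by move=> mA; apply: product_measure_unique => // B C mB mC; exact: product_measure2E.
Qed.

Lemma leb2_upper {R : realType} (s t : R)
    (A : set (P2 R)) : s != 0 -> measurable A ->
  leb2 R A = (`|s|%:E * leb2 R ((fun z => (s * z.1 + t * z.2, z.2)%R) @^-1` A))%E.
Proof.
move=> s0 mA.
have mB : measurable ((fun z => (s * z.1 + t * z.2, z.2)%R) @^-1` A :
     set (P2 R)).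
  rewrite -[_ @^-1` _]setTI.
  suff: measurable_fun setT (fun z : P2 R =>
     (s * z.1 + t * z.2, z.2)) by apply.
  apply: measurable_fun_pair => //=.
  by apply: measurable_funD; apply: measurable_funM.
rewrite !leb2_swap // /product_measure2 /= -ge0_integralZl //; last first.
  exact: measurable_fun_ysection.
apply: eq_integral => y _ /=.
rewrite (lebesgue_measure_affine (t * y) s0); last exact: measurable_ysection.
by congr (_ * _)%E; congr lebesgue_measure.
Qed.

(** A matrix with [a != 0] is a lower triangular map after an upper triangular one, and each of
    these acts affinely on slices. Only the sign of the factor is recorded, because every integral
    transported later is compared with 0. *)
Lemma leb2_linmap {R : realType} (a b c d : R) : a * d - b * c != 0 ->
  exists2 k : R, 0 < k &
  forall A : set (P2 R), measurable A ->
    leb2 R A = (k%:E * leb2 R (linmap a b c d @^-1` A))%E.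
Proof.
wlog a0 : a b c d / a != 0 => [wlg det0|det0].
  have [a0|a0] := eqVneq a 0; last exact: wlg.
  have [||k k0 kE] := wlg (a - b) b (c - d) d.
  - rewrite a0 sub0r oppr_eq0; apply: contra_neq det0 => ->; rewrite a0; ring.
  (* Composing with the shear that adds the first coordinate to the second turns the matrix with
     columns col1 - col2, col2 back into the original one; its corner entry [a - b] is nonzero
     here. *)
  - by have -> : (a - b) * d - b * (c - d) = a * d - b * c by ring.
  exists k => [//|A mA].
  rewrite (kE _ mA) (leb2_lower 1 (oner_neq0 R) (measurable_linmap_preimage (a - b) b (c - d) d mA)).
  rewrite normr1 mul1e -comp_preimage (_ : linmap _ _ _ _ \o _ = linmap a b c d) //.
  by apply/funext => z; congr pair; rewrite /=; ring.
pose s := (a * d - b * c) / a.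
have s0 : s != 0 by rewrite mulf_neq0 // invr_eq0.
exists (`|s| * `|a|) => [|A mA]; first by rewrite mulr_gt0 ?normr_gt0.
rewrite (leb2_lower (c / a) s0 mA) (leb2_upper b a0); last first.
  have := measurable_linmap_preimage 1 0 (c / a) s mA.
  rewrite (_ : linmap _ _ _ _ = fun z => (z.1, s * z.2 + c / a * z.1)) //.
  by apply/funext => z; congr pair; ring.
rewrite muleA -EFinM -comp_preimage (_ : _ \o _ = linmap a b c d) //.
by apply/funext => z; congr pair; rewrite /= /s; field.
Qed.

Lemma integral_linmap {R : realType} (a b c d : R) : a * d - b * c != 0 ->
  exists2 k : R, 0 < k &
  forall (D : set (P2 R)) (f : P2 R -> R),
    measurable (D : set (P2 R)) ->
    measurable_fun setT (f : P2 R -> R) ->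
    (leb2 R).-integrable (linmap a b c d @^-1` D) (EFin \o (f \o linmap a b c d)) ->
    \int[leb2 R]_(z in D) f z =
    k * \int[leb2 R]_(z in linmap a b c d @^-1` D) f (linmap a b c d z).
Proof.
move=> det0; have [k k0 kE] := leb2_linmap det0; exists k => // D f mD mf intf.
have mphi := @measurable_linmap R a b c d.
have k0' : 0 <= k by exact: ltW.
pose psh : {measure set (P2 R) -> \bar R} :=
  
  (pushforward (leb2 R) (linmap a b c d :
      P2 R -> P2 R)).
pose psh1 := psh mphi.
pose nu : {measure set (P2 R) -> \bar R} :=
  mscale (NngNum k0') psh1.
have ge0 (g : P2 R -> \bar R) : measurable_fun setT (g : P2 R -> \bar R) ->
    (forall z, 0 <= g z)%E ->
    (\int[leb2 R]_(z in D) g z = k%:E * \int[leb2 R]_(z in linmap a b c d @^-1` D) g (linmap a b c d z))%E.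
  move=> mg g0.
  rewrite (eq_measure_integral nu) => [|A mA _]; last by rewrite /nu /mscale /= kE.
  have mgD : measurable_fun D g by exact: measurable_funTS.
  rewrite (@ge0_integral_mscale _ _ R psh1 D mD (NngNum k0') g mgD (fun x _ => g0 x)).
  exact: (congr1 (mule k%:E)
    (@ge0_integral_pushforward _ _ _ _ R _ mphi (leb2 R) D g mD mgD (fun x _ => g0 x))).
have mEf : measurable_fun setT (EFin \o f : P2 R -> \bar R) by exact/measurable_EFinP.
have mD' : measurable (linmap a b c d @^-1` D : set (P2 R)).
  exact: measurable_linmap_preimage.
have fp := integrable_pos_fin_num mD' intf.
have fn := integrable_neg_fin_num mD' intf.
rewrite /Rintegral.
have -> : (\int[leb2 R]_(x in D) (f x)%:E =
    k%:E * \int[leb2 R]_(x in linmap a b c d @^-1` D) (f (linmap a b c d x))%:E)%E.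
  rewrite [LHS]integralE.
  rewrite (ge0 _ (measurable_funepos mEf)) // (ge0 _ (measurable_funeneg mEf)) //.
  have Ep : (fun z => (EFin \o f)^\+ (linmap a b c d z))%E =
      ((EFin \o (f \o linmap a b c d))^\+)%E.
    by apply/funext => z; rewrite !funeposE.
  have En : (fun z => (EFin \o f)^\- (linmap a b c d z))%E =
      ((EFin \o (f \o linmap a b c d))^\-)%E.
    by apply/funext => z; rewrite !funenegE.
  rewrite Ep En; etransitivity; last first.
    exact: (congr1 (mule k%:E) (esym (integralE (leb2 R) _ (EFin \o (f \o linmap a b c d))))).
  by apply/esym/muleBr => //; exact: fin_num_adde_defr fp.
by rewrite fineM // ?integrable_fin_num //.
Qed.

Lemma continuous_measurable2 {R : realType} (f : R * R -> R) :
  continuous f -> measurable_fun setT (f : P2 R -> R).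
Proof.
move=> /continuousP cf; apply: (measurability _ (RGenOpens.measurableE R)).
move=> _ [_ [a [b ->] <-]]; rewrite setTI; apply: open_measurable2.
exact/cf/interval_open.
Qed.

Lemma bounded_setP2 {R : realType} (A : set (R * R)) : bounded_set A ->
  exists2 M : R, 0 < M & forall z, A z -> `|z.1| <= M /\ `|z.2| <= M.
Proof.
move=> [M0 [_ bA]]; have M1 : M0 < `|M0| + 1 by rewrite ltr_pwDr // ler_norm.
exists (`|M0| + 1) => [|z /(bA _ M1)]; first by rewrite ltr_wpDl.
by rewrite /= prod_normE ge_max => /andP.
Qed.

Lemma bounded_leb2_lty {R : realType} (A : set (P2 R)) (M : R) : measurable A ->
  (forall z, A z -> `|z.1| <= M /\ `|z.2| <= M) -> (leb2 R A < +oo)%E.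
Proof.
move=> mA AM.
pose I : set (measurableTypeR R) := `[- M, M]%classic.
have mI : measurable I by exact: measurable_itv.
apply: (@le_lt_trans _ _ (leb2 R (I `*` I))).
  apply: le_measure; rewrite ?inE //; first exact: measurableX.
  by move=> z /AM[z1 z2]; split; rewrite /I /= in_itv /= -ler_norml.
have -> : leb2 R (I `*` I) = (lebesgue_measure I * lebesgue_measure I)%E.
  exact: (product_measure1E (@lebesgue_measure R) (@lebesgue_measure R) mI mI).
rewrite /I lebesgue_measure_itv /=; case: ifP => _; last by rewrite mule0 ltry.
by rewrite -EFinB -EFinM ltry.
Qed.

Lemma integrable_bounded {d} {T : measurableType d} {R : realType}
    (mu : {measure set T -> \bar R}) (A : set T) (f : T -> R) (M : R) :
  measurable A -> (mu A < +oo)%E -> measurable_fun A f ->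
  (forall z, A z -> `|f z| <= M) -> mu.-integrable A (EFin \o f).
Proof.
move=> mA Aoo mf fM; apply: measurable_bounded_integrable => //.
exists M; split; first exact: num_real.
by move=> M' MM' z Az; exact: le_trans (fM z Az) (ltW MM').
Qed.

(** * Integrals in one variable *)

Lemma Rintegral_FTC2_within {R : realType} (F f : R -> R) (a b : R) : a < b ->
  (forall x, a <= x <= b -> is_derive x (1 : R) F (f x)) ->
  (forall x, a <= x <= b -> {for x, continuous f}) ->
  \int[lebesgue_measure]_(x in `[a, b]) f x = F b - F a.
Proof.
move=> ab dF cf.
have cF (x : R) : a <= x <= b -> {for x, continuous F}.
  by move=> /dF[df _]; apply/differentiable_continuous/derivable1_diffP.
have aab : a <= a <= b by rewrite lexx ltW.
have bab : a <= b <= b by rewrite lexx ltW.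
rewrite /Rintegral (@continuous_FTC2 _ f F) //.
- by apply: continuous_in_subspaceT => x /set_mem /=; rewrite in_itv /= => /cf.
- split.
  + move=> x /=; rewrite in_itv /= => /andP[ax xb].
    by have [] := dF x ltac:(by rewrite (ltW ax) (ltW xb)).
  + by apply: cvg_at_right_filter; exact: cF.
  + by apply: cvg_at_left_filter; exact: cF.
- move=> x; rewrite in_itv /= => /andP[ax xb]; rewrite derive1E.
  by have [_ ->] := dF x ltac:(by rewrite (ltW ax) (ltW xb)).
Qed.

Lemma Rintegral_FTC2 {R : realType} (F f : R -> R) (a b : R) : a <= b ->
  (forall x, is_derive x (1 : R) F (f x)) -> continuous f ->
  \int[lebesgue_measure]_(x in `[a, b]) f x = F b - F a.
Proof.
rewrite le_eqVlt => /predU1P[-> _ _|ab dF cf].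
  by rewrite set_itv1 Rintegral_set1 subrr.
exact: (Rintegral_FTC2_within ab (fun x _ => dF x) (fun x _ => cf x)).
Qed.

Lemma ler_cos_pi {R : realType} (a b : R) : 0 <= a -> a <= b -> b <= pi ->
  cos b <= cos a.
Proof.
move=> a0 ab bpi; rewrite leNgt ltr_cos ?in_itv /= -?leNgt //.
- by rewrite bpi (le_trans a0).
- by rewrite a0 (le_trans ab).
Qed.

(** Concavity of sin on [0, pi], from the mean value theorem and the monotonicity of cos. *)
Lemma sin_tangent {R : realType} (a b : R) : 0 <= a <= pi -> 0 <= b <= pi ->
  sin a - sin b <= cos b * (a - b).
Proof.
move=> /andP[a0 api] /andP[b0 bpi].
have csin (x y : R) : {within `[x, y], continuous (@sin R)}.
  by apply: continuous_subspaceT; exact: continuous_sin.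
have [ab|ba] := leP a b.
  have [c] := @MVT_segment R sin cos a b ab (fun x _ => is_derive_sin x) (csin a b).
  rewrite in_itv /= => /andP[ac cb] E.
  rewrite -opprB E -mulrN opprB; apply: ler_wnM2r; first by rewrite subr_le0.
  by apply: ler_cos_pi => //; exact: le_trans ac.
have [c] := @MVT_segment R sin cos b a (ltW ba) (fun x _ => is_derive_sin x) (csin b a).
rewrite in_itv /= => /andP[bc ca] ->; apply: ler_wpM2r; first by rewrite subr_ge0 ltW.
by apply: ler_cos_pi => //; exact: le_trans api.
Qed.

Lemma ler_cos_pi_mul {R : realType} (a b : R) : 0 <= a -> a <= b -> b <= 1 ->
  cos (pi * b) <= cos (pi * a).
Proof.
move=> a0 ab b1; have p0 := pi_gt0 R; apply: ler_cos_pi.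
- by rewrite mulr_ge0 // ltW.
- by rewrite ler_pM2l.
- by rewrite ger_pMr.
Qed.

Lemma sin_tangent_pi {R : realType} (a b : R) : 0 <= a <= 1 -> 0 <= b <= 1 ->
  sin (pi * a) / pi - sin (pi * b) / pi <= cos (pi * b) * (a - b).
Proof.
move=> /andP[a0 a1] /andP[b0 b1]; have p0 := pi_gt0 R.
rewrite -mulrBl ler_pdivrMr // -mulrA [_ * pi]mulrC mulrBr.
by apply: sin_tangent; rewrite ger_pMr // mulr_ge0 // ltW.
Qed.

(** Jordan's inequality. The tangent at [pi / 2 * k] lies above the graph at 0 and at [pi / 2];
    weighting these two facts by [1 - k] and [k] cancels the slope. *)
Lemma sin_pihalf_ge {R : realType} (k : R) : 0 <= k <= 1 -> k <= sin (pi / 2 * k).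
Proof.
move=> /andP[k0 k1]; have p0 := pi_gt0 R.
have bk : 0 <= pi / 2 * k <= pi by apply/andP; split; nra.
have h0 := @sin_tangent R 0 (pi / 2 * k) ltac:(apply/andP; split; lra) bk.
have h1 := @sin_tangent R (pi / 2) (pi / 2 * k) ltac:(apply/andP; split; lra) bk.
rewrite sin0 in h0; rewrite sin_pihalf in h1; nra.
Qed.

Lemma cos_pi_le {R : realType} (k : R) : 0 <= k <= 1 -> cos (pi * k) <= 1 - 2 * k ^+ 2.
Proof.
move=> k01; have := sin_pihalf_ge k01; move: (k01) => /andP[k0 k1] h.
have -> : pi * k = (pi / 2 * k) *+ 2 by rewrite mulr2n; lra.
rewrite cos_mulr2n cos2sin2 mulr2n; nra.
Qed.

(** The second integral equals (1 - 2 k^2 - cos (pi k)) / (k pi^2), which is nonnegative by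
    [cos_pi_le] and is 0 for k = 1. *)
Lemma triangle_profile_ge0 {R : realType} (k : R) : 0 < k <= 1 ->
  let tau (h : R) : R := Num.max 0 (1 - h / k) in
  \int[lebesgue_measure]_(h in `[0, 1]) tau h = k / 2 /\
  0 <= \int[lebesgue_measure]_(h in `[0, 1]) (tau h * cos (pi * h) - sin (pi * tau h) / pi).
Proof.
move=> /andP[k0 k1] tau.
have p0 := pi_gt0 R; have k_neq0 : k != 0 by rewrite gt_eqF.
have p_neq0 : (pi : R) != 0 by rewrite gt_eqF.
have cut (f g : R -> R) : (forall h, 0 <= h <= k -> f h = g h) ->
    (forall h, k < h -> f h = 0) ->
    \int[lebesgue_measure]_(h in `[0, 1]) f h =
    \int[lebesgue_measure]_(h in `[0, k]) g h.
  move=> fg f0; rewrite Rintegral_mkcond [RHS]Rintegral_mkcond.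
  apply: eq_Rintegral => h _; rewrite !patchE !mem_setE !in_itv /=.
  case: (leP 0 h) => //= h0; case: (leP h k) => hk.
    by rewrite (le_trans hk k1) fg // h0.
  by rewrite f0 //; case: ifP.
have tauE h : 0 <= h <= k -> tau h = 1 - h / k.
  by move=> /andP[h0 hk]; apply/max_idPr; rewrite subr_ge0 ler_pdivrMr // mul1r.
have tau0 h : k < h -> tau h = 0.
  by move=> kh; apply/max_idPl; rewrite subr_le0 ler_pdivlMr // mul1r ltW.
split.
  rewrite (cut _ (fun h => 1 - h / k)) //.
  pose F (h : R) : R := h - h ^+ 2 / (2 * k).
  have dF (x : R) : is_derive x (1 : R) F (1 - x / k).
    by apply: is_derive_eq; rewrite /GRing.scale /=; field.
  have cf : continuous (fun h : R => 1 - h / k).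
    by move=> x; apply: cvgB; [exact: cvg_cst|apply: cvgMl; exact: cvg_id].
  by rewrite (Rintegral_FTC2 (ltW k0) dF cf) /F expr0n /= mul0r; field.
pose f h : R := (1 - h / k) * cos (pi * h) - sin (pi * (1 - h / k)) / pi.
pose F h : R := (1 - h / k) * sin (pi * h) / pi - cos (pi * h) / (k * pi ^+ 2)
  - k / pi ^+ 2 * cos (pi * (1 - h / k)).
rewrite (cut _ f); last 2 first.
- by move=> h hk; rewrite tauE.
- by move=> h hk; rewrite tau0 // mul0r mulr0 sin0 mul0r subr0.
have dF (x : R) : is_derive x (1 : R) F (f x).
  apply: is_derive_eq; rewrite /GRing.scale /= /f.
  set c := cos (pi * x); set s := sin (pi * x); set s' := sin (pi * (1 - x / k)).
  move: c s s' => c s s'; move: (pi : R) p_neq0 => q q0.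
  by field; rewrite k_neq0 q0.
have cf : continuous f.
  move=> x; apply/differentiable_continuous/derivable1_diffP.
  by rewrite /f.
rewrite (Rintegral_FTC2 (ltW k0) dF cf) /F divff // subrr !mulr0 !mul0r sin0 mulr0.
rewrite !mul0r subr0 mulr1 cospi !cos0.
have := @cos_pi_le R k ltac:(by apply/andP; split; lra).
set c := cos (pi * k) => hc.
have -> : (0 - c / (k * pi ^+ 2) - k / pi ^+ 2 * 1 -
   (0 - 1 / (k * pi ^+ 2) - k / pi ^+ 2 * -1)) =
   (1 - 2 * k ^+ 2 - c) / (k * pi ^+ 2).
  move: (pi : R) p_neq0 c {hc} => q q0 c.
  by field; rewrite k_neq0 q0.
by rewrite divr_ge0 ?subr_ge0 // mulr_ge0 ?sqr_ge0 // ltW.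
Qed.

(* [2 * w h] is the length of the slice at height [h] of a cap.  With equal
   integrals, the triangle profile [tau k h = max (0, 1 - h / k)] is the worst
   case: [w - tau k] changes sign once, from + to -, at [h0], and the tangent
   inequality for sin bounds the difference of the two integrands below by a
   constant multiple of [w - tau k]. *)
Lemma concave_profile_ge0 {R : realType} (w : measurableTypeR R -> R) :
  measurable_fun setT w ->
  (forall h, 0 < h <= 1 -> 0 <= w h <= 1 - h) ->
  (forall h h', 0 < h' -> h' < h -> h <= 1 -> 0 < w h ->
    1 - h' / h + h' / h * w h <= w h') ->
  0 <= \int[lebesgue_measure]_(h in `]0, 1]) (w h * cos (pi * h) - sin (pi * w h) / pi).
Proof.
move=> mw0 w01 wconc.
have p0 := pi_gt0 R; have p_neq0 : (pi : R) != 0 by rewrite gt_eqF.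
pose I : set (measurableTypeR R) := `]0, 1]%classic.
have mI : measurable I by exact: measurable_itv.
have Ioo : (lebesgue_measure I < +oo)%E by rewrite /I lebesgue_measure_itv /= lte_fin ltr01 -EFinB ltry.
pose Th (x h : R) := x * cos (pi * h) - sin (pi * x) / pi.
have mw : measurable_fun I w by exact: measurable_funTS.
have mid : measurable_fun I (fun h : measurableTypeR R => h) by [].
have mTh (g : measurableTypeR R -> R) : measurable_fun I g -> measurable_fun I (fun h => Th (g h) h).
  move=> mg; apply: measurable_funB; apply: measurable_funM => //.
    apply: (@measurableT_comp _ _ _ _ _ _ (@cos R)); first exact: continuous_measurable_fun (@continuous_cos R).
    exact: measurable_funM.
  apply: (@measurableT_comp _ _ _ _ _ _ (@sin R)); first exact: continuous_measurable_fun (@continuous_sin R).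
  exact: measurable_funM.
have iw (g : measurableTypeR R -> R) : measurable_fun I g -> (forall h, I h -> 0 <= g h <= 1) ->
    lebesgue_measure.-integrable I (EFin \o g).
  move=> mg g01; apply: (@integrable_bounded _ _ _ _ _ _ 1) => // h /g01 /andP[g0 g1].
  by rewrite ger0_norm.
have iTh (g : measurableTypeR R -> R) : measurable_fun I g -> (forall h, I h -> 0 <= g h <= 1) ->
    lebesgue_measure.-integrable I (EFin \o (fun h => Th (g h) h)).
  move=> mg g01; apply: (@integrable_bounded _ _ _ _ _ _ (1 + pi^-1)) => //; first exact: mTh.
  move=> h /g01 /andP[g0 g1]; rewrite /Th (le_trans (ler_normB _ _)) // lerD //.
    rewrite normrM ger0_norm // mulr_ile1 // ler_norml cos_geN1 cos_le1 //.
  have pinv : 0 <= (pi : R)^-1 by rewrite invr_ge0 ltW.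
  rewrite normrM (ger0_norm pinv) -[leRHS]mul1r ler_wpM2r // ler_norml.
  by rewrite sin_geN1 sin_le1.
have wI h : I h -> 0 <= w h <= 1.
  rewrite /I /= in_itv /= => h01; have /andP[-> w1] := w01 h h01.
  by rewrite (le_trans w1) // gerBl ltW //; case/andP: h01.
have intw := iw w mw wI; have intTw := iTh w mw wI.
pose tau k (h : measurableTypeR R) : R := Num.max 0 (1 - h / k).
have mtau k : measurable_fun I (tau k).
  by apply: measurable_maxr => //; apply: measurable_funB => //; exact: measurable_funM.
have tau01 k h : 0 < k -> 0 <= h -> 0 <= tau k h <= 1.
  move=> k0 h0; rewrite le_max lexx /= ge_max ler01 /= gerBl divr_ge0 // ltW //.
have I0 h : I h -> 0 < h <= 1 by rewrite /I /= in_itv.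
have tauI k h : 0 < k -> I h -> 0 <= tau k h <= 1.
  by move=> k0 /I0 /andP[/ltW h0 _]; exact: tau01.
pose J := \int[lebesgue_measure]_(h in I) w h.
have tri k : 0 < k <= 1 -> \int[lebesgue_measure]_(h in I) tau k h = k / 2 /\
    0 <= \int[lebesgue_measure]_(h in I) Th (tau k h) h.
  move=> k01; have k0 : 0 < k by case/andP: k01.
  have [E1 E2] := triangle_profile_ge0 k01; rewrite /I; split.
    by rewrite Rintegral_itv_obnd_cbnd //; apply: iw => // h; exact: tauI.
  by rewrite Rintegral_itv_obnd_cbnd //; apply: iTh => // h; exact: tauI.
have J0 : 0 <= J by apply: Rintegral_ge0 => h /wI /andP[].
have J2 : J <= 1 / 2.
  have <- := (tri 1 ltac:(by rewrite ltr01 lexx)).1.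
  apply: le_Rintegral => //; first by apply: iw => // h; exact: tauI.
  by move=> h /I0 /w01 /andP[_ w1]; rewrite le_max divr1 w1 orbT.
(* The comparison triangle has k = 2 J, which must be positive. If J = 0, the bounds sin (pi w) <=
   pi w and cos >= -1 put the integrand above - 2 w, whose integral is 0. *)
have [J_eq0|J_neq0] := eqVneq J 0.
  apply: (@le_trans _ _ (- 2 * J)); first by rewrite J_eq0 mulr0.
  rewrite -(RintegralZl _ mI intw); apply: (le_Rintegral mI) => //.
    by have := integrableZl mI (-2) intw; apply: eq_integrable.
  move=> h Ih; have /andP[w0 w1] := wI h Ih.
  have := @sin_tangent_pi R (w h) 0 ltac:(lra) ltac:(lra).
  rewrite mulr0 sin0 mul0r cos0 !subr0 mul1r => sw.
  have := cos_geN1 (pi * h : R); nra.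
have J01 : 0 < 2 * J <= 1 by apply/andP; split; [rewrite mulr_gt0 // lt_neqAle eq_sym J_neq0|lra].
have [k [k01 kE [Et Ht]]] : exists k, [/\ 0 < k <= 1, k = 2 * J &
    \int[lebesgue_measure]_(h in I) tau k h = k / 2 /\
    0 <= \int[lebesgue_measure]_(h in I) Th (tau k h) h].
  by exists (2 * J); split => //; exact: tri.
have k0 : 0 < k by case/andP: k01.
(* The crossing height is the supremum of the heights where [w] exceeds the triangle; 0 is adjoined
   so that the set is never empty. *)
pose S : set R := [set 0] `|` [set h | 0 < h <= 1 /\ tau k h < w h].
have supS : has_sup S.
  split; first by exists 0; left.
  by exists 1 => h [->|[/andP[]]].
pose h0 := sup S.
have h0_ge0 : 0 <= h0 by apply: ub_le_sup; [exact: supS.2|left].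
have h0_le1 : h0 <= 1 by apply: ge_sup => [|h [->|[/andP[]]]]; [exact: supS.1|..].
(* The triangle profile is the line from (0, 1) to (k, 0), cut off at 0. If [w] is above it at [s],
   then [w] is above it on all of ]0, s[, because [wconc] is concavity as seen from the point (0,
   1). *)
have below h : I h -> h < h0 -> tau k h <= w h.
  move=> Ih hh0; have /andP[hp h1] := I0 h Ih; have /andP[wh0 _] := wI h Ih.
  have [s Ss hs] : exists2 s, S s & h < s.
    by have [s Ss hs] := sup_gt supS.1 hh0; exists s.
  case: Ss hs => [->|[/andP[s0 s1] ts] hs]; first by rewrite ltNge ltW.
  rewrite ge_max wh0 /=.
  have ts0 : 0 <= tau k s by have /andP[] := tau01 k s k0 (ltW s0).
  have ts1 : 1 - s / k <= tau k s by rewrite le_max lexx orbT.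
  have ws := wconc s h hp hs s1 (le_lt_trans ts0 ts).
  apply: le_trans ws.
  have : h / s * (1 - s / k) <= h / s * w s.
    by apply: ler_wpM2l; [rewrite divr_ge0 // ltW|exact: le_trans ts1 (ltW ts)].
  have -> : h / s * (1 - s / k) = h / s - h / k by field; rewrite !gt_eqF.
  lra.
have above h : I h -> h0 < h -> w h <= tau k h.
  move=> Ih h0h; rewrite leNgt; apply/negP => tw; move: h0h; rewrite ltNge => /negP; apply.
  by apply: ub_le_sup; [exact: supS.2|right; split => //; exact: I0].
have tau_anti x y : x <= y -> tau k y <= tau k x.
  move=> xy; rewrite ge_max le_max lexx /= le_max; apply/orP; right.
  by rewrite lerD2l lerN2 ler_pM2r ?invr_gt0.
(* The tangent inequality bounds Th (w h) h - Th (tau k h) h below by (cos (pi h) - cos (pi tau k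
   h)) d h. The first factor is nonincreasing in h and [C0] is its value at the crossing, where [d]
   passes from + to -, so replacing the factor by [C0] can only decrease the product. *)
pose C0 := cos (pi * h0) - cos (pi * tau k h0).
pose d h := w h - tau k h.
have key h : I h -> Th (tau k h) h + C0 * d h <= Th (w h) h.
  move=> Ih; have /andP[hp h1] := I0 h Ih.
  have /andP[wh0 wh1] := wI h Ih; have /andP[t0 t1] := tauI k h k0 Ih.
  have /andP[t00 t01] := tau01 k h0 k0 h0_ge0.
  have sgn : 0 <= (cos (pi * h) - cos (pi * tau k h) - C0) * d h.
    rewrite /C0 /d; have [hh|hh|->] := ltgtP h h0; last by rewrite subrr mul0r.
      apply: mulr_ge0; last by rewrite subr_ge0 below.
      have := @ler_cos_pi_mul R h h0 (ltW hp) (ltW hh) h0_le1.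
      have := tau_anti _ _ (ltW hh) => tt.
      have := @ler_cos_pi_mul R (tau k h0) (tau k h) t00 tt t1.
      lra.
    apply: mulr_le0; last by rewrite subr_le0 above.
    have := @ler_cos_pi_mul R h0 h h0_ge0 (ltW hh) h1.
    have := tau_anti _ _ (ltW hh) => tt.
    have := @ler_cos_pi_mul R (tau k h) (tau k h0) t0 tt t01.
    lra.
  have := @sin_tangent_pi R (w h) (tau k h) (wI h Ih) (tauI k h k0 Ih).
  move: sgn; rewrite /Th /d; set cw := cos (pi * h); set ct := cos (pi * tau k h).
  set sw := sin (pi * w h) / pi; set st := sin (pi * tau k h) / pi; lra.
have itau : lebesgue_measure.-integrable I (EFin \o tau k) by apply: iw => // h; exact: tauI.
have iTtau : lebesgue_measure.-integrable I (EFin \o (fun h => Th (tau k h) h)).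
  by apply: iTh => // h; exact: tauI.
have id0 : lebesgue_measure.-integrable I (EFin \o d).
  by have := integrableB mI intw itau; apply: eq_integrable.
have iC : lebesgue_measure.-integrable I (EFin \o (fun h => C0 * d h)).
  by have := integrableZl mI C0 id0; apply: eq_integrable.
have : \int[lebesgue_measure]_(h in I) (Th (tau k h) h + C0 * d h) <=
       \int[lebesgue_measure]_(h in I) Th (w h) h.
  apply: le_Rintegral => //.
  by have := integrableD mI iTtau iC; apply: eq_integrable.
apply: le_trans; rewrite (RintegralD mI iTtau iC) (RintegralZl _ mI id0) (RintegralB mI intw itau) Et -/J.
have -> : J - k / 2 = 0 by rewrite kE [2 * J]mulrC mulfK ?pnatr_eq0 // subrr.
by rewrite mulr0 addr0.
Qed.

Lemma Rintegral_xsection {R : realType} (C : set (P2 R)) (f : P2 R -> R) (M B : R) :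
  measurable C -> (forall z, C z -> `|z.1| <= M /\ `|z.2| <= M) ->
  measurable_fun setT f -> (forall z, C z -> `|f z| <= B) ->
  let g (u : measurableTypeR R) :=
    \int[lebesgue_measure]_(v in xsection C u) f (u, v) in
  lebesgue_measure.-integrable setT (EFin \o g) /\
  \int[leb2 R]_(z in C) f z = \int[lebesgue_measure]_u g u.
Proof.
move=> mC CM mf fB g.
have Coo := bounded_leb2_lty mC CM.
have intf : (leb2 R).-integrable C (EFin \o f).
  by apply: (integrable_bounded mC Coo _ fB); exact: measurable_funTS.
have intfC : (leb2 R).-integrable setT (EFin \o (f \_ C)).
  by have /(integrable_mkcond (EFin \o f) mC) := intf; rewrite restrict_EFin.
have slice u : (\int[lebesgue_measure]_v ((f \_ C) (u, v))%:E)%E = (g u)%:E.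
  have mCu : measurable (xsection C u) by exact: measurable_xsection.
  have Cuoo : (lebesgue_measure (xsection C u) < +oo)%E.
    apply: (@le_lt_trans _ _ (lebesgue_measure (`[- M, M]%classic : set R))).
      apply: le_measure; rewrite ?inE //.
      by move=> v; rewrite /xsection /= => /set_mem /CM[_]; rewrite /= in_itv /= ler_norml.
    by rewrite lebesgue_measure_itv /=; case: ifP => _; rewrite ?ltry // -EFinB ltry.
  have intu : lebesgue_measure.-integrable (xsection C u) (EFin \o (fun v => f (u, v))).
    apply: (@integrable_bounded _ _ _ _ _ _ B) => //.
      by apply: measurable_funTS; exact: (measurableT_comp mf (pair1_measurable u)).
    by move=> v; rewrite /xsection /= => /set_mem /fB.
  rewrite /g /Rintegral fineK; last by apply: integrable_fin_num.
  rewrite [RHS]integral_mkcond; apply: eq_integral => v _.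
  by rewrite /= !patchE mem_xsection; case: ifP.
have FE : fubini_F (@lebesgue_measure R) (EFin \o (f \_ C)) = EFin \o g.
  by apply/funext => u; rewrite /fubini_F /= slice.
split; first by rewrite -FE; exact: integrable_fubini_F.
rewrite Rintegral_mkcond {1}/Rintegral -integral12_prod_meas1 //.
by rewrite FE.
Qed.

Lemma bounded_intervalE {R : realType} (S : set R) (M : R) : is_interval S ->
  (forall x, S x -> `|x| <= M) ->
  exists a b c d, S = [set` Interval (BSide c a) (BSide d b)].
Proof.
move=> /is_intervalP SE SM.
have lS : has_lbound S by exists (- M) => x /SM; rewrite ler_norml => /andP[].
have uS : has_ubound S by exists M => x /SM; rewrite ler_norml => /andP[].
rewrite SE /Rhull (asboolT lS) (asboolT uS).
by exists (inf S), (sup S), `[< S (inf S) >], (~~ `[< S (sup S) >]).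
Qed.

(** For an interval with midpoint c and length l the integral is 2 cos (pi c) sin (pi l / 2) / pi. A
    length of at most 2 keeps the sine nonnegative, so the interval centred at 0 is the worst case
    and the position of a slice can be forgotten. *)
Lemma Rintegral_cos_interval {R : realType} (S : set R) (M : R) : is_interval S ->
  (forall x, S x -> `|x| <= M) -> fine (lebesgue_measure S) <= 2 ->
  \int[lebesgue_measure]_(v in S) cos (pi * v) <=
  2 * (sin (pi * (fine (lebesgue_measure S) / 2)) / pi).
Proof.
move=> iS SM; have [a [b [c [d SE]]]] := bounded_intervalE iS SM.
have p0 := pi_gt0 R; have p_neq0 : (pi : R) != 0 by rewrite gt_eqF.
have cc : continuous (fun v : R => cos (pi * v)).
  by move=> x; apply: continuous_comp; [exact: mulrl_continuous|exact: continuous_cos].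
have mc (D : set (measurableTypeR R)) : measurable_fun D (fun v : R => (cos (pi * v))%:E).
  by apply/measurable_EFinP; apply: measurable_funTS; exact: continuous_measurable_fun.
have LE : lebesgue_measure S = if (a < b)%R then (b - a)%:E else 0%E.
  by rewrite SE lebesgue_measure_itv /= lte_fin EFinB.
rewrite LE SE /Rintegral integral_itv_bndoo {LE}; last exact: mc.
case: ltP => [ab|ba] /= ab2; last first.
  by rewrite set_itv_ge ?bnd_simp -?leNgt // integral_set0 /= mul0r mulr0 sin0 mul0r mulr0.
rewrite -(@integral_itv_bndoo _ a b _ true false); last exact: mc.
pose F (v : R) := sin (pi * v) / pi.
have dF (x : R) : is_derive x (1 : R) F (cos (pi * x)).
  apply: is_derive_eq; rewrite /GRing.scale /=.
  by rewrite !mulr0 add0r mulr1 mulrCA mulVf // mulr1.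
have := Rintegral_FTC2 (ltW ab) dF cc; rewrite /Rintegral => ->.
rewrite /F -mulrBl mulrA ler_pM2r ?invr_gt0 //.
have -> : pi * b = pi * ((a + b) / 2) + pi * ((b - a) / 2) by field.
have -> : pi * a = pi * ((a + b) / 2) - pi * ((b - a) / 2) by field.
rewrite sinD sinB.
have s0 : 0 <= sin (pi * ((b - a) / 2)).
  apply: sin_ge0_pi; apply/andP; split; first by rewrite mulr_ge0 // ?divr_ge0 ?subr_ge0 // ltW.
  by rewrite ger_pMr // ler_pdivrMr // mul1r.
have := cos_le1 (pi * ((a + b) / 2)); nra.
Qed.

Lemma Rintegral_shift {R : realType} (c : R) (D : set (measurableTypeR R))
    (f : measurableTypeR R -> R) : measurable D -> measurable_fun setT f ->
  lebesgue_measure.-integrable ((fun x => c + x) @^-1` D) (EFin \o (fun x => f (c + x))) ->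
  \int[lebesgue_measure]_(x in D) f x =
  \int[lebesgue_measure]_(x in (fun x => c + x) @^-1` D) f (c + x).
Proof.
move=> mD mf intf.
have mphi : measurable_fun setT ((fun x => c + x) : measurableTypeR R -> measurableTypeR R).
  exact: measurable_funD.
pose psh : {measure set (measurableTypeR R) -> \bar R} :=
  (pushforward (@lebesgue_measure R)
    ((fun x => c + x) : measurableTypeR R -> measurableTypeR R)).
have E (A : set (measurableTypeR R)) : measurable A -> A `<=` D -> lebesgue_measure A = psh mphi A.
  move=> mA _; rewrite (lebesgue_measure_affine c (oner_neq0 R) mA) normr1 mul1e.
  rewrite /psh /= /pushforward; congr lebesgue_measure.
  by apply/seteqP; split => x /=; rewrite mul1r addrC.
rewrite /Rintegral (eq_measure_integral (psh mphi) E); congr fine.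
by apply: (@integral_pushforward _ _ _ _ _ _ mphi lebesgue_measure D (EFin \o f)) => //; exact/measurable_EFinP.
Qed.

Lemma bounded_interval_measure {R : realType} (S : set R) (M : R) : is_interval S ->
  (forall x, S x -> `|x| <= M) ->
  exists a b, [/\ a <= b, (forall x, a < x < b -> S x) &
    lebesgue_measure S = (b - a)%:E].
Proof.
move=> iS SM; have [a [b [c [d SE]]]] := bounded_intervalE iS SM.
have LE : lebesgue_measure S = if (a < b)%R then (b - a)%:E else 0%E.
  by rewrite SE lebesgue_measure_itv /= lte_fin EFinB.
have [ab|ba] := ltP a b; rewrite ?ab in LE.
  exists a, b; split => //; first exact: ltW.
  move=> x /andP[ax xb]; rewrite SE /= in_itv.
  by case: (c); case: (d); rewrite /= ?ax ?xb ?(ltW ax) ?(ltW xb).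
exists 0, 0; split => //.
  by move=> x /andP[x0 x1]; have := lt_trans x0 x1; rewrite ltxx.
by rewrite subrr LE ltNge ba.
Qed.

(** * The caps of a tilted body *)

Section Cap.
Context {R : realType} (K : set (P2 R)) (M m : R).
Hypothesis mK : measurable K.
Hypothesis KM : forall z, K z -> `|z.1| <= M /\ `|z.2| <= M.
Hypothesis Kconv : forall (x y : P2 R) (t : R), K x -> K y -> 0 <= t <= 1 ->
  K (t * x.1 + (1 - t) * y.1, t * x.2 + (1 - t) * y.2).
Hypothesis Ksquare : forall u v, `|u| < 1 -> `|v| < 1 -> K (u, v).
Hypothesis m1 : `|m| <= 1.
Hypothesis Ktilt1 : forall u v, K (u, v) -> (1 - m) * u + (1 + m) * v <= 2.
Hypothesis Ktilt2 : forall u v, K (u, v) -> (1 + m) * u - (1 - m) * v <= 2.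

Let S u := xsection K u.
Let ell u := fine (lebesgue_measure (S u)).

Let SE u v : S u v <-> K (u, v).
Proof. by rewrite /S /xsection /= inE. Qed.

Let S_itv u : is_interval (S u).
Proof.
move=> x y /SE Kx /SE Ky z /andP[xz zy]; apply/SE.
have [xy|xy] := eqVneq x y.
  by have -> : z = x by apply: le_anti; rewrite xz xy zy.
have yx : 0 < y - x by rewrite subr_gt0 lt_neqAle xy (le_trans xz).
have t01 : 0 <= (y - z) / (y - x) <= 1.
  by rewrite divr_ge0 ?ler_pdivrMr ?mul1r ?lerD2l ?lerN2 ?subr_ge0 ?(le_trans xz).
have := Kconv Kx Ky t01 => /=.
by congr K; congr pair; field; rewrite gt_eqF.
Qed.

Let S_M u v : S u v -> `|v| <= M.
Proof. by move=> /SE /KM []. Qed.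

Let S_len u : exists a b, [/\ a <= b, (forall x, a < x < b -> S u x) & ell u = b - a].
Proof.
have [a [b [ab abS mS]]] := bounded_interval_measure (S_itv (u := u)) (S_M (u := u)).
by exists a, b; split => //; rewrite /ell mS.
Qed.

(** One strip bounds the slice from above and the other from below. Together they give (1 - m^2) (v2
    - v1) <= 2 (1 - m^2) - 2 h (1 + m^2), and 1 + m^2 >= 1 - m^2. If |m| = 1, one of the strips
    reads u <= 1 and the slice is empty. *)
Let width h v1 v2 : 0 < h -> S (1 + h) v1 -> S (1 + h) v2 -> v2 - v1 <= 2 - 2 * h.
Proof.
move=> h0 /SE /Ktilt2 t2 /SE /Ktilt1 t1; move: m1; rewrite ler_norml => /andP[ml mr].
have m1' : 0 < (1 - m) * (1 + m).
  rewrite lt_neqAle mulr_ge0 ?subr_ge0 // ?andbT; last lra.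
  apply/eqP => /esym /eqP; rewrite mulf_eq0 => /orP[/eqP e|/eqP e].
    by have := t2; nra.
  by have := t1; nra.
rewrite -(ler_pM2l m1').
have h1 : (1 - m) * ((1 + m) * v2) <= (1 - m) * (2 - (1 - m) * (1 + h)) by apply: ler_wpM2l; lra.
have h2 : (1 + m) * (- (1 - m) * v1) <= (1 + m) * (2 - (1 + m) * (1 + h)) by apply: ler_wpM2l; lra.
have : 0 <= h * m ^+ 2 by rewrite mulr_ge0 ?sqr_ge0 // ltW.
nra.
Qed.

Let ell_le h : 0 < h <= 1 -> ell (1 + h) <= 2 - 2 * h.
Proof.
move=> /andP[h0 h1]; have [a [b [ab abS ->]]] := S_len (1 + h).
rewrite leNgt; apply/negP => lt; pose e := (b - a - (2 - 2 * h)) / 4.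
have := @width h (a + e) (b - e) h0 (abS _ _) (abS _ _).
by rewrite /e; move=> /(_ ltac:(lra) ltac:(lra)); lra.
Qed.

Let ell_ge0 u : 0 <= ell u.
Proof. by have [a [b [ab _ ->]]] := S_len u; rewrite subr_ge0. Qed.

(** Only the open square is given inside [K], so its side u = 1 has to be reached from beyond: (1,
    v) is a convex combination of the cap point and a point of the open square. The weight [s] of
    the cap point is small enough to keep the other point in the square. *)
Let Kedge h v0 v : 0 < h -> K (1 + h, v0) -> `|v| < 1 -> K (1, v).
Proof.
move=> h0 K0 v1; pose s := (1 - `|v|) / (2 * (1 + `|v0| + h)).
have d0 : 0 < 2 * (1 + `|v0| + h) by have := normr_ge0 v0; lra.
have s0 : 0 < s by rewrite divr_gt0 // subr_gt0.
have sE : s * (2 * (1 + `|v0| + h)) = 1 - `|v| by rewrite divfK // gt_eqF.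
have [nv nv0] := (normr_ge0 v, normr_ge0 v0).
have sv0 : 0 <= s * `|v0| by rewrite mulr_ge0 // ltW.
have sh : 0 < s * h by rewrite mulr_gt0.
have s1 : 0 < 1 - s by nra.
have s1' : 1 - s != 0 by rewrite gt_eqF.
have Kin : K ((1 - s * (1 + h)) / (1 - s), (v - s * v0) / (1 - s)).
  apply: Ksquare.
    by rewrite ltr_norml ltr_pdivrMr // ltr_pdivlMr //; apply/andP; split; nra.
  rewrite normrM (gtr0_norm (x := (1 - s)^-1)) ?invr_gt0 // ltr_pdivrMr // mul1r.
  by apply: le_lt_trans (ler_normB _ _) _; rewrite normrM gtr0_norm //; nra.
have := Kconv (t := s) K0 Kin; rewrite /= (ltW s0) => /(_ ltac:(lra)).
by congr K; congr pair; field.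
Qed.

(** Brunn-Minkowski in dimension one, between the slice at 1 + h and the side u = 1, which has
    length 2. A slice of positive length supplies the cap point that [Kedge] asks for; convex
    combinations of points at equal relative positions [l] then fill ]A, B[. *)
Let ell_concave h h' : 0 < h' -> h' < h -> h <= 1 -> 0 < ell (1 + h) ->
  2 * (1 - h' / h) + h' / h * ell (1 + h) <= ell (1 + h').
Proof.
move=> h'0 h'h h1; have h0 : 0 < h by lra.
have [a [b [ab abS ->]]] := S_len (1 + h); rewrite subr_gt0 => {}ab.
pose t := h' / h.
have t0 : 0 < t by rewrite divr_gt0.
have t1 : t < 1 by rewrite ltr_pdivrMr // mul1r.
have th : t * h = h' by rewrite divfK // gt_eqF.
rewrite -/t.
pose A := t * a - (1 - t); pose B := t * b + (1 - t).
have AB : A < B by rewrite /A /B; nra.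
have sub : `]A, B[%classic `<=` S (1 + h').
  move=> y /=; rewrite in_itv /= => /andP[Ay yB].
  pose l := (y - A) / (B - A).
  have BA : 0 < B - A by rewrite subr_gt0.
  have l0 : 0 < l by rewrite divr_gt0 // subr_gt0.
  have l1 : l < 1 by rewrite ltr_pdivrMr // mul1r ltrD2r.
  have lE : y = A + l * (B - A) by rewrite divfK ?gt_eqF // addrC subrK.
  have K1 : K (1 + h, a + l * (b - a)) by apply/SE/abS; apply/andP; split; nra.
  have K2 : K (1, - 1 + 2 * l).
    by apply: (Kedge h0 K1); rewrite ltr_norml; apply/andP; split; lra.
  apply/SE; have := Kconv (t := t) K1 K2; rewrite /= (ltW t0) (ltW t1) => /(_ isT).
  by congr K; congr pair; [rewrite -th; ring|rewrite lE /A /B; ring].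
have -> : 2 * (1 - t) + t * (b - a) = B - A by rewrite /A /B; ring.
rewrite /ell; have [a' [b' [ab' _ E]]] := bounded_interval_measure (S_itv (u := 1 + h')) (S_M (u := 1 + h')).
have : (lebesgue_measure (`]A, B[%classic : set R) <= lebesgue_measure (S (1 + h')%R))%E.
  by apply: le_measure; rewrite ?inE //; exact: measurable_xsection.
by rewrite lebesgue_measure_itv /= lte_fin AB E lee_fin.
Qed.

Let w h := ell (1 + h) / 2.

Let mw : measurable_fun setT (w : measurableTypeR R -> R).
Proof.
apply: measurable_funM => //.
have m0 : measurable_fun setT (ell : measurableTypeR R -> R).
  apply: (@measurableT_comp _ _ _ _ _ _ fine) => //.
  exact: (measurable_fun_xsection (@lebesgue_measure R) mK).
by apply: (measurableT_comp m0); exact: measurable_funD.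
Qed.

(** On the slice u = 1 + h of length 2 w the integral is at most - 2 w cos (pi h) + 2 sin (pi w) /
    pi: the first term is exact since cos (pi u) = - cos (pi h), the second is
    [Rintegral_cos_interval]. Integrating in h leaves -2 times the quantity of
    [concave_profile_ge0]. *)
Lemma cap_integral_le0 :
  \int[leb2 R]_(z in K `&` [set z | 1 < z.1]) (cos (pi * z.1) + cos (pi * z.2)) <= 0.
Proof.
pose C := K `&` [set z : P2 R | 1 < z.1].
have p0 := pi_gt0 R.
have mC : measurable C.
  apply: measurableI => //.
  have -> : [set z : P2 R | 1 < z.1] = `]1, +oo[%classic `*` setT.
    by apply/seteqP; split => z /=; rewrite in_itv /= andbT // => -[].
  exact: measurableX.
have CM z : C z -> `|z.1| <= M /\ `|z.2| <= M by move=> [/KM].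
pose f (z : P2 R) : R := cos (pi * z.1) + cos (pi * z.2).
have mf : measurable_fun setT f.
  apply: measurable_funD; apply: (@measurableT_comp _ _ _ _ _ _ (@cos R));
    try exact: measurable_funM; exact: continuous_measurable_fun (@continuous_cos R).
have fB z : C z -> `|f z| <= 2.
  move=> _; rewrite (le_trans (ler_normD _ _)) // -[leRHS]/(1 + 1) lerD //;
  by rewrite ler_norml cos_geN1 cos_le1.
have [ig ->] := Rintegral_xsection mC CM mf fB.
set g := (X in lebesgue_measure.-integrable _ (EFin \o X)) in ig *.
pose T h := - 2 * (w h * cos (pi * h) - sin (pi * w h) / pi).
pose I1 : set (measurableTypeR R) := `]0, 1]%classic.
pose I2 : set (measurableTypeR R) := `]1, 2]%classic.
have mI1 : measurable I1 by exact: measurable_itv.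
have mI2 : measurable I2 by exact: measurable_itv.
have I1oo : (lebesgue_measure I1 < +oo)%E.
  by rewrite /I1 lebesgue_measure_itv /= lte_fin ltr01 -EFinB ltry.
have I2oo : (lebesgue_measure I2 < +oo)%E.
  by rewrite /I2 lebesgue_measure_itv /= lte_fin ltr1n -EFinB ltry.
have I2E u : I2 u -> 0 < u - 1 <= 1.
  by rewrite /I2 /= in_itv /= => /andP[? ?]; apply/andP; split; lra.
have w01 h : 0 < h <= 1 -> 0 <= w h <= 1 - h.
  move=> h01; have := ell_le h01; have := ell_ge0 (1 + h); rewrite /w.
  by move=> ? ?; apply/andP; split; lra.
have mT : measurable_fun setT (T : measurableTypeR R -> R).
  apply: measurable_funM => //; apply: measurable_funB; apply: measurable_funM => //;
   [apply: (@measurableT_comp _ _ _ _ _ _ (@cos R))|apply: (@measurableT_comp _ _ _ _ _ _ (@sin R))];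
    try exact: measurable_funM; apply: continuous_measurable_fun;
    [exact: continuous_cos|exact: continuous_sin].
have TB h : 0 < h <= 1 -> `|T h| <= 2 * (1 + pi^-1).
  move=> h01; have /andP[w0 w1] := w01 h h01; have /andP[hp h1] := h01.
  have pinv : 0 <= (pi : R)^-1 by rewrite invr_ge0 ltW.
  rewrite /T normrM normrN [`|2|]ger0_norm // ler_wpM2l // (le_trans (ler_normB _ _)) // lerD //.
    rewrite normrM (ger0_norm w0) mulr_ile1 // ?ler_norml ?cos_geN1 ?cos_le1 //.
    by rewrite (le_trans w1) // gerBl ltW.
  rewrite normrM (ger0_norm pinv) -[leRHS]mul1r ler_wpM2r // ler_norml.
  by rewrite sin_geN1 sin_le1.
have iT1 : lebesgue_measure.-integrable I1 (EFin \o T).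
  apply: (integrable_bounded mI1 I1oo (M := 2 * (1 + pi^-1))); first exact: measurable_funTS.
  by move=> h; rewrite /I1 /= in_itv /=; exact: TB.
have mTs : measurable_fun setT ((fun u => T (u - 1)) : measurableTypeR R -> R).
  by apply: (measurableT_comp mT); exact: measurable_funB.
have iT2 : lebesgue_measure.-integrable I2 (EFin \o (fun u => T (u - 1))).
  apply: (integrable_bounded mI2 I2oo (M := 2 * (1 + pi^-1))); first exact: measurable_funTS.
  by move=> u /I2E; exact: TB.
have gI2 : \int[lebesgue_measure]_u g u = \int[lebesgue_measure]_(u in I2) g u.
  rewrite [RHS]Rintegral_mkcond; apply: eq_Rintegral => u _; rewrite patchE.
  case: ifPn => // /negP uI; rewrite /g (_ : xsection C u = set0) ?Rintegral_set0 //.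
  apply/seteqP; split => // v; rewrite /xsection /= => /set_mem [Kuv u1].
  apply: uI; apply/mem_set; rewrite /I2 /= in_itv /= u1 /=.
  (* With both points equal, [width] says 0 <= 2 - 2 h, so the cap ends at u = 2. *)
  have := @width (u - 1) v v; rewrite subr_gt0 u1 addrC subrK => /(_ isT).
  by move=> /(_ ltac:(exact/SE) ltac:(exact/SE)); lra.
have gT u : I2 u -> g u <= T (u - 1).
  move=> Iu; have /andP[h0 h1] := I2E u Iu; rewrite /g.
  have -> : xsection C u = S u.
    apply/seteqP; split => v; rewrite /S /xsection /= !inE; first by case.
    by split => //; rewrite /= -subr_gt0.
  have mS : measurable (S u) by exact: measurable_xsection.
  have [a [b [ab _ mE]]] := bounded_interval_measure (S_itv (u := u)) (S_M (u := u)).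
  have Soo : (lebesgue_measure (S u) < +oo)%E by rewrite mE ltry.
  have uE : u = 1 + (u - 1) by rewrite addrC subrK.
  have l2 : ell u <= 2 by have := ell_le (I2E u Iu); rewrite -uE; lra.
  have cB (c : measurableTypeR R -> R) : measurable_fun setT c -> (forall v, `|c v| <= 1) ->
      lebesgue_measure.-integrable (S u) (EFin \o c).
    by move=> mc c1; apply: (integrable_bounded mS Soo (M := 1)) => //; exact: measurable_funTS.
  have nc x : `|cos x : R| <= 1 by rewrite ler_norml cos_geN1 cos_le1.
  rewrite RintegralD //=; last 2 first.
  - by apply: cB => //; exact: measurable_cst.
  - apply: cB => //; apply: (@measurableT_comp _ _ _ _ _ _ (@cos R)); last exact: measurable_funM.
    exact: continuous_measurable_fun (@continuous_cos R).
  rewrite Rintegral_cst // -/(ell u).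
  have := Rintegral_cos_interval (S_itv (u := u)) (S_M (u := u)) l2; rewrite -/(ell u).
  rewrite /T /w -uE; have -> : cos (pi * u) = - cos (pi * (u - 1)).
    by rewrite -cosDpi; congr cos; ring.
  set x := sin _ / _; set y := cos _; move: (ell u) => l; lra.
rewrite gI2; have g2 : lebesgue_measure.-integrable I2 (EFin \o g).
  exact: integrableS ig.
apply: le_trans (le_Rintegral mI2 g2 iT2 gT) _.
have pre : (fun x => 1 + x) @^-1` I2 = I1.
  apply/seteqP; split => x; rewrite /I1 /I2 /= !in_itv /= => /andP[? ?]; apply/andP; split; lra.
have TE : (fun x => T (1 + x - 1)) = T by apply/funext => x; rewrite addrC addKr.
rewrite (Rintegral_shift (c := 1) mI2 mTs) /= pre ?TE //.
have iT0 : lebesgue_measure.-integrable I1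
    (EFin \o (fun h => w h * cos (pi * h) - sin (pi * w h) / pi)).
  have := integrableZl mI1 (- (2^-1)) iT1; apply: eq_integrable => // h _.
  by rewrite /T /= -EFinM mulrA mulrNN mulVf ?mul1r.
rewrite (RintegralZl _ mI1 iT0) mulr_le0_ge0 //.
apply: concave_profile_ge0 => //.
move=> h h' h'0 h'h h1; rewrite /w => lh.
have l0 : 0 < ell (1 + h) by move: lh; rewrite pmulr_lgt0 ?invr_gt0.
have := ell_concave h'0 h'h h1 l0; set t := h' / h; lra.
Qed.
End Cap.

Lemma Rintegral_setIC {d} {T : measurableType d} {R : realType}
    (mu : {measure set T -> \bar R}) (A D : set T) (f : T -> R) :
  measurable A -> measurable D -> mu.-integrable A (EFin \o f) ->
  \int[mu]_(x in A) f x =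
  \int[mu]_(x in A `&` D) f x + \int[mu]_(x in A `&` ~` D) f x.
Proof.
move=> mA mD intf; rewrite -[in LHS](setUIDK A D) setDE Rintegral_setU //.
- exact: measurableI.
- by apply: measurableI => //; exact: measurableC.
- by rewrite -setDE setUIDK.
- by apply/disj_setPS => x [[_ Dx] [_ /(_ Dx)]].
Qed.

(* The image of Omega under [(u, v) = (X + Y, X - Y)]; the two strips are
   [|X - m Y| <= 1] and [|Y + m X| <= 1]. *)
Record tilted_body {R : realType} (M m : R) (K : set (P2 R)) : Prop := TiltedBody {
  tilted_measurable : measurable K;
  tilted_bounded : forall z, K z -> `|z.1| <= M /\ `|z.2| <= M;
  tilted_convex : forall (x y : P2 R) (t : R), K x -> K y -> 0 <= t <= 1 ->
    K (t * x.1 + (1 - t) * y.1, t * x.2 + (1 - t) * y.2);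
  tilted_square : forall u v, `|u| < 1 -> `|v| < 1 -> K (u, v);
  tilted_slope : `|m| <= 1;
  tilted_strip1 : forall u v, K (u, v) -> `|(1 - m) * u + (1 + m) * v| <= 2;
  tilted_strip2 : forall u v, K (u, v) -> `|(1 + m) * u - (1 - m) * v| <= 2 }.

Section FourCaps.
Context {R : realType}.
Let f (z : P2 R) : R := cos (pi * z.1) + cos (pi * z.2).
Let rot : P2 R -> P2 R := linmap 0 (-1) 1 0.

Let mf : measurable_fun setT f.
Proof.
apply: measurable_funD; apply: (@measurableT_comp _ _ _ _ _ _ (@cos R));
  try exact: measurable_funM; exact: continuous_measurable_fun (@continuous_cos R).
Qed.

Let intf (A : set (P2 R)) M : measurable A ->
  (forall z, A z -> `|z.1| <= M /\ `|z.2| <= M) ->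
  (leb2 R).-integrable A (EFin \o f).
Proof.
move=> mA AM; apply: (integrable_bounded mA (bounded_leb2_lty mA AM) (M := 2)).
  exact: measurable_funTS.
move=> z _; rewrite (le_trans (ler_normD _ _)) // -[leRHS]/(1 + 1) lerD //;
by rewrite ler_norml cos_geN1 cos_le1.
Qed.

Let f_rot z : f (rot z) = f z.
Proof.
by rewrite /f /rot /linmap /= mul0r add0r mulN1r mul1r mul0r addr0 mulrN cosN addrC.
Qed.

Let tilted_rot M m K : tilted_body M m K -> tilted_body M m (rot @^-1` K).
Proof.
have rotE z : rot z = (- z.2, z.1).
  by rewrite /rot /linmap mul0r add0r mulN1r mul1r mul0r addr0.
case=> mK KM Kc Ks m1 K1 K2; split => //.
- exact: measurable_linmap_preimage.
- by move=> z; rewrite /= rotE => /KM /=; rewrite normrN => -[].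
- move=> x y t; rewrite /= !rotE => Kx Ky t01; have := Kc _ _ _ Kx Ky t01.
  by rewrite /=; congr K; congr pair; ring.
- by move=> u v u1 v1; rewrite /= rotE; apply: Ks; rewrite ?normrN.
- move=> u v; rewrite /= rotE => /K2 /=; rewrite -normrN; congr (`|_| <= _); ring.
- move=> u v; rewrite /= rotE => /K1 /=; congr (`|_| <= _); ring.
Qed.

Let rot_det : (0 : R) * 0 - (-1) * 1 != 0.
Proof. by rewrite mul0r sub0r mulN1r opprK oner_neq0. Qed.

Let half_measurable (P : P2 R -> R) c : measurable_fun setT P -> measurable [set z | c < P z].
Proof.
move=> mP; have -> : [set z | c < P z] = setT `&` P @^-1` `]c, +oo[%classic.
  by apply/seteqP; split => z /=; rewrite in_itv /= andbT // => -[].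
by apply: mP => //; exact: measurable_itv.
Qed.

(** The integrand is invariant under the quarter turn, and the turned body is again tilted with the
    same [m]. The bound is therefore assumed for all tilted bodies at once; starting from the cap
    z.1 > 1, three turns reach the other caps. *)
Let cap_rot (P P' : P2 R -> R) : measurable_fun setT P -> P' = P \o rot ->
  (forall M m K, tilted_body M m K -> \int[leb2 R]_(z in K `&` [set z | 1 < P' z]) f z <= 0) ->
  forall M m K, tilted_body M m K -> \int[leb2 R]_(z in K `&` [set z | 1 < P z]) f z <= 0.
Proof.
move=> mP -> cap M m K tK; have [k k0 kE] := integral_linmap rot_det.
have mD : measurable (K `&` [set z | 1 < P z]).
  by apply: measurableI; [exact: tilted_measurable tK|exact: half_measurable].
have tK' := tilted_rot tK.
rewrite kE //; last first.
  rewrite (_ : f \o _ = f); last by apply/funext => z; exact: f_rot.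
  apply: (@intf _ M); first exact: measurable_linmap_preimage.
  by move=> z [/(tilted_bounded tK')].
rewrite mulr_ge0_le0 ?(ltW k0) //.
rewrite (@eq_Rintegral _ _ _ (leb2 R) _ f); last by move=> z _; exact: f_rot.
exact: cap tK'.
Qed.

Lemma four_caps_le0 M m K : tilted_body M m K ->
  [/\ \int[leb2 R]_(z in K `&` [set z | 1 < z.1]) f z <= 0,
      \int[leb2 R]_(z in K `&` [set z | 1 < z.2]) f z <= 0,
      \int[leb2 R]_(z in K `&` [set z | 1 < - z.1]) f z <= 0 &
      \int[leb2 R]_(z in K `&` [set z | 1 < - z.2]) f z <= 0].
Proof.
have cap1 M' m' K' : tilted_body M' m' K' ->
    \int[leb2 R]_(z in K' `&` [set z | 1 < z.1]) f z <= 0.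
  case=> mK KM Kc Ks m1 K1 K2; apply: (cap_integral_le0 mK KM Kc Ks m1).
    by move=> u v /K1; apply: le_trans; exact: ler_norm.
  by move=> u v /K2; apply: le_trans; exact: ler_norm.
have rotE z : rot z = (- z.2, z.1).
  by rewrite /rot /linmap mul0r add0r mulN1r mul1r mul0r addr0.
have cap2 : forall M' m' K', tilted_body M' m' K' ->
    \int[leb2 R]_(z in K' `&` [set z | 1 < z.2]) f z <= 0.
  apply: (cap_rot measurable_snd _ cap1).
  by apply/funext => z; rewrite /comp rotE.
have cap3 : forall M' m' K', tilted_body M' m' K' ->
    \int[leb2 R]_(z in K' `&` [set z | 1 < - z.1]) f z <= 0.
  apply: (cap_rot (measurable_funN measurable_fst) _ cap2).
  by apply/funext => z; rewrite /comp rotE /= opprK.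
have cap4 : forall M' m' K', tilted_body M' m' K' ->
    \int[leb2 R]_(z in K' `&` [set z | 1 < - z.2]) f z <= 0.
  apply: (cap_rot (measurable_funN measurable_snd) _ cap3).
  by apply/funext => z; rewrite /comp rotE.
by move=> tK; split; [exact: cap1 tK|exact: cap2 tK|exact: cap3 tK|exact: cap4 tK].
Qed.

Lemma square_integral0 :
  \int[leb2 R]_(z in `]-1, 1[%classic `*` `]-1, 1[%classic) f z = 0.
Proof.
pose I : set (measurableTypeR R) := `]-1, 1[%classic.
have mI : measurable I by exact: measurable_itv.
have IE x : I x -> `|x| <= 1 by rewrite /I /= in_itv /= -ltr_norml => /ltW.
have fB z : (I `*` I) z -> `|f z| <= 2.
  move=> _; rewrite (le_trans (ler_normD _ _)) // -[leRHS]/(1 + 1) lerD //;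
  by rewrite ler_norml cos_geN1 cos_le1.
have [ig ->] := Rintegral_xsection (M := 1) (measurableX mI mI)
  (fun z Iz => conj (IE _ Iz.1) (IE _ Iz.2)) mf fB.
have p0 := pi_gt0 R; have p_neq0 : (pi : R) != 0 by rewrite gt_eqF.
have LI : lebesgue_measure I = 2%:E.
  rewrite /I lebesgue_measure_itv /= lte_fin ifT; last lra.
  by rewrite -EFinB; congr EFin; lra.
have Ioo : (lebesgue_measure I < +oo)%E by rewrite LI ltry.
have leI : fine (lebesgue_measure I) = 2 by rewrite LI.
have ic (c : measurableTypeR R -> R) : measurable_fun setT c ->
    lebesgue_measure.-integrable I (EFin \o (fun v => cos (c v))).
  move=> mc; apply: (integrable_bounded mI Ioo (M := 1)).
  - apply: measurable_funTS; apply: (@measurableT_comp _ _ _ _ _ _ (@cos R)) => //.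
    exact: continuous_measurable_fun (@continuous_cos R).
  - by move=> v _; rewrite ler_norml cos_geN1 cos_le1.
have mcos : measurable_fun setT ((fun v => pi * v) : measurableTypeR R -> R).
  exact: measurable_funM.
have cosI : \int[lebesgue_measure]_(v in I) cos (pi * v) = 0.
  have cc : continuous (fun v : R => cos (pi * v)).
    by move=> x; apply: continuous_comp; [exact: mulrl_continuous|exact: continuous_cos].
  pose F (v : R) := sin (pi * v) / pi.
  have dF (x : R) : is_derive x (1 : R) F (cos (pi * x)).
    apply: is_derive_eq; rewrite /GRing.scale /=.
    by rewrite !mulr0 add0r mulr1 mulrCA mulVf // mulr1.
  have := Rintegral_FTC2 (a := -1) (b := 1) ltac:(lra) dF cc.
  rewrite /F mulr1 mulrN1 sinN sinpi oppr0 !mul0r subrr /Rintegral => <-; congr fine.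
  rewrite (@integral_itv_bndoo _ (-1) 1 _ true false) //.
  exact: (measurable_int (@lebesgue_measure R) (ic _ mcos)).
have gI u : I u -> \int[lebesgue_measure]_(v in xsection (I `*` I) u) f (u, v) = 2 * cos (pi * u).
  move=> Iu; have -> : xsection (I `*` I) u = I.
    by apply/seteqP; split => v; rewrite /xsection /= inE => // -[].
  rewrite (RintegralD mI (ic _ _) (ic _ _)) /=; last 2 first.
  - by [].
  - exact: mcos.
  by rewrite Rintegral_cst // cosI leI addr0 mulrC.
transitivity (\int[lebesgue_measure]_(u in I) (2 * cos (pi * u))).
  rewrite [RHS]Rintegral_mkcond; apply: eq_Rintegral => u _; rewrite patchE.
  case: ifPn => [/set_mem /gI //|/negP uI].
  rewrite (_ : xsection _ _ = set0) ?Rintegral_set0 //; apply/seteqP; split => // v.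
  by rewrite /xsection /= inE => -[/= Iu _]; apply: uI; exact: mem_set.
by rewrite (RintegralZl _ mI (ic _ mcos)) cosI mulr0.
Qed.

(** Up to a null set, [K] is the disjoint union of the open square and the four caps. A point with
    both |u| > 1 and |v| > 1 would violate a strip inequality, since its weights 1 - m and 1 + m are
    nonnegative with sum 2. *)
Lemma tilted_integral_le0 M m K : tilted_body M m K ->
  \int[leb2 R]_(z in K) (cos (pi * z.1) + cos (pi * z.2)) <= 0.
Proof.
move=> tK; have [c1 c2 c3 c4] := four_caps_le0 tK.
have mK := tilted_measurable tK; have KM := tilted_bounded tK.
pose Q : set (P2 R) := `]-1, 1[%classic `*` `]-1, 1[%classic.
have mQ : measurable Q by apply: measurableX; exact: measurable_itv.
pose H (P : P2 R -> R) := [set z | 1 < P z].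
have mH P : measurable_fun setT P -> measurable (H P) by exact: half_measurable.
have m1 : measurable (H fst) by apply: mH; exact: measurable_fst.
have m2 : measurable (H snd) by apply: mH; exact: measurable_snd.
have m3 : measurable (H (\- fst)%R) by apply: mH; exact: measurable_funN measurable_fst.
have m4 : measurable (H (\- snd)%R) by apply: mH; exact: measurable_funN measurable_snd.
have sub_int (A : set (P2 R)) : measurable A -> A `<=` K -> (leb2 R).-integrable A (EFin \o f).
  by move=> mA AK; apply: (@intf _ M) => // z /AK /KM.
have mC (A B : set (P2 R)) : measurable A -> measurable B -> measurable (A `&` ~` B).
  by move=> mA mB; apply: measurableI => //; exact: measurableC.
have corner p q a b : 0 <= p -> 0 <= q -> p + q = 2 -> 1 < a -> 1 < b -> 2 < p * a + q * b :> R.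
  move=> p0 q0 pq a1 b1; have [p1|p1] := leP p 1.
    have : 0 <= p * (a - 1) by rewrite mulr_ge0 // subr_ge0 ltW.
    have : 0 < q * (b - 1) by rewrite mulr_gt0 ?subr_gt0 //; lra.
    by lra.
  have : 0 < p * (a - 1) by rewrite mulr_gt0 ?subr_gt0 //; lra.
  have : 0 <= q * (b - 1) by rewrite mulr_ge0 // subr_ge0 ltW.
  by lra.
move: (tilted_slope tK); rewrite ler_norml => /andP[ml mr].
have ma : 0 <= 1 - m by lra.
have mb : 0 <= 1 + m by lra.
have t1 u v : K (u, v) -> 1 < u -> 1 < v -> False.
  move=> /(tilted_strip1 tK); rewrite ler_norml => /andP[_ h] u1 v1.
  by have := corner _ _ _ _ ma mb ltac:(lra) u1 v1; lra.
have t2 u v : K (u, v) -> 1 < - u -> 1 < - v -> False.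
  move=> /(tilted_strip1 tK); rewrite ler_norml => /andP[h _] u1 v1.
  by have := corner _ _ _ _ ma mb ltac:(lra) u1 v1; lra.
have t3 u v : K (u, v) -> 1 < u -> 1 < - v -> False.
  move=> /(tilted_strip2 tK); rewrite ler_norml => /andP[_ h] u1 v1.
  by have := corner _ _ _ _ mb ma ltac:(lra) u1 v1; lra.
have t4 u v : K (u, v) -> 1 < - u -> 1 < v -> False.
  move=> /(tilted_strip2 tK); rewrite ler_norml => /andP[h _] u1 v1.
  by have := corner _ _ _ _ mb ma ltac:(lra) u1 v1; lra.
pose A1 := K `&` ~` H fst.
pose A2 := A1 `&` ~` H (\- fst)%R.
pose A3 := A2 `&` ~` H snd.
pose A4 := A3 `&` ~` H (\- snd)%R.
have mA1 : measurable A1 by exact: mC.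
have mA2 : measurable A2 by exact: mC.
have mA3 : measurable A3 by exact: mC.
have mA4 : measurable A4 by exact: mC.
have A1K : A1 `<=` K by move=> z [].
have A2K : A2 `<=` K by move=> z [/A1K].
have A3K : A3 `<=` K by move=> z [/A2K].
have A4K : A4 `<=` K by move=> z [/A3K].
rewrite -/f.
rewrite (Rintegral_setIC mK m1 (sub_int K mK (@subset_refl _ K))) -/A1.
rewrite (Rintegral_setIC mA1 m3 (sub_int A1 mA1 A1K)) -/A2.
rewrite (Rintegral_setIC mA2 m2 (sub_int A2 mA2 A2K)) -/A3.
rewrite (Rintegral_setIC mA3 m4 (sub_int A3 mA3 A3K)) -/A4.
rewrite (Rintegral_setIC mA4 mQ (sub_int A4 mA4 A4K)).
have -> : A1 `&` H (\- fst)%R = K `&` [set z | 1 < - z.1].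
  apply/seteqP; split => -[u v] => [[[Kz _] h]//|[Kz /= h]].
  by do 2 split => //; rewrite /H /= => h'; lra.
have -> : A2 `&` H snd = K `&` [set z | 1 < z.2].
  apply/seteqP; split => -[u v] => [[[[Kz _] _] h]//|[Kz /= h]].
  split; last exact: h.
  split; last by move=> h'; exact: (t4 u v).
  by split => // h'; exact: (t1 u v).
have -> : A3 `&` H (\- snd)%R = K `&` [set z | 1 < - z.2].
  apply/seteqP; split => -[u v] => [[[[[Kz _] _] _] h]//|[Kz /= h]].
  split; last exact: h.
  split; last by rewrite /H /= => h'; lra.
  split; last by move=> h'; exact: (t2 u v).
  by split => // h'; exact: (t3 u v).
have -> : A4 `&` Q = Q.
  apply/seteqP; split => [z []//|[u v] [/= u1 v1]]; move: (u1) (v1).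
  rewrite !in_itv /= => /andP[ua ub] /andP[va vb]; split => //.
  split; last by rewrite /H /= => h'; lra.
  split; last by rewrite /H /= => h'; lra.
  split; last by rewrite /H /= => h'; lra.
  split; last by rewrite /H /= => h'; lra.
  by apply: (tilted_square tK); rewrite ltr_norml ?ua ?va.
have mB : measurable (A4 `&` ~` Q) by exact: mC.
pose L : set (measurableTypeR R) := [set 1] `|` [set -1].
have mL : measurable L by apply: measurableU; exact: measurable_set1.
have L0 : lebesgue_measure L = 0%E.
  by apply: countable_lebesgue_measure0; apply: finite_set_countable; rewrite finite_setU; split; exact: finite_set1.
have mLT : measurable (L `*` setT : set (P2 R)) by exact: measurableX.
have mTL : measurable (setT `*` L : set (P2 R)) by exact: measurableX.
(* What is left after removing caps and square lies on the four lines |u| = 1 and |v| = 1. *)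
have B0 : leb2 R (A4 `&` ~` Q) = 0%E.
  apply/eqP; rewrite eq_le measure_ge0 andbT.
  apply: (@le_trans _ _ (leb2 R ((L `*` setT) `|` (setT `*` L)))).
    apply: le_measure; rewrite ?inE //; first exact: measurableU.
    move=> [u v] [[[[[_ h1] h3] h2] h4] nQ]; rewrite /H /= in h1 h2 h3 h4.
    have [u1|u1] := eqVneq `|u| 1.
      left; split => //=; move: u1; rewrite /L /=.
      by case: (ger0P u) => _ E; [left|right; rewrite -E opprK].
    right; split => //; rewrite /L /=.
    move/negP: h1; move/negP: h2; move/negP: h3; move/negP: h4; rewrite -!leNgt => h4 h3 h2 h1.
    have {}u1 : `|u| < 1 by rewrite lt_neqAle u1 ler_norml h1 lerNl h3.
    have v1 : ~ (`|v| < 1).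
      move=> v1; apply: nQ; split; rewrite /= in_itv /=; first by rewrite -ltr_norml.
      by rewrite -ltr_norml.
    have {}v1 : 1 <= `|v| by rewrite leNgt; exact/negP.
    move: v1; case: (ger0P v) => _ v1; [left|right]; apply: le_anti.
      by rewrite h2.
    by rewrite lerNr v1 lerNl h4.
  apply: le_trans (measureU2 _ mLT mTL) _.
  have E1 := etrans (product_measure1E (@lebesgue_measure R) (@lebesgue_measure R) mL measurableT)
    (etrans (congr1 (fun x => x * _)%E L0) (mul0e _)).
  have E2 := etrans (product_measure1E (@lebesgue_measure R) (@lebesgue_measure R) measurableT mL)
    (etrans (congr1 (fun x => _ * x)%E L0) (mule0 _)).
  have /eqP := etrans (f_equal2 (fun x y => x + y)%E E1 E2) (adde0 0%E).
  by rewrite eq_le => /andP[].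
have -> : \int[leb2 R]_(z in A4 `&` ~` Q) f z = 0.
  rewrite /Rintegral null_set_integral //.
  by apply/measurable_EFinP; exact: measurable_funTS.
rewrite square_integral0 !addr0.
have add0 (x y : R) : x <= 0 -> y <= 0 -> x + y <= 0 by move=> ? ?; lra.
apply: (add0 _ _ c1); apply: (add0 _ _ c3); exact: (add0 _ _ c2 c4).
Qed.
End FourCaps.

(** * A frame of conjugate directions *)

(* A single number [a] gives a supporting functional at both axes: this is the
   first-order condition for the maximum at [(1, 0)] expressed by the last
   hypothesis. *)
Lemma norm_conjugate_frame {R : realType} (G : R -> R -> R) :
  (forall x y x' y', G (x + x') (y + y') <= G x y + G x' y') ->
  (forall c x y, G (c * x) (c * y) = `|c| * G x y) ->
  0 < G 1 0 -> 0 < G 0 1 ->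
  (forall c s, G (- s) c ^+ 2 - G c s ^+ 2 <= (G 0 1 ^+ 2 - G 1 0 ^+ 2) * (c ^+ 2 + s ^+ 2)) ->
  exists2 a, `|a| <= G 1 0 &
    forall x y, a * x + G 0 1 * y <= G x y /\
      G 1 0 * x - G 0 1 * a / G 1 0 * y <= G x y.
Proof.
move=> Gadd Ghom.
set N1 := G 1 0; set N2 := G 0 1 => N1p N2p Gmax.
have G01 y : 0 <= y -> G 0 y = y * N2.
  by move=> y0; rewrite -{2}(ger0_norm y0) -Ghom mulr0 mulr1.
have G10 x : 0 <= x -> G x 0 = x * N1.
  by move=> x0; rewrite -{2}(ger0_norm x0) -Ghom mulr0 mulr1.
have Gpos c x y : 0 <= c -> G (c * x) (c * y) = c * G x y.
  by move=> c0; rewrite Ghom ger0_norm.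
have GN x y : G (- x) (- y) = G x y.
  by rewrite -(mulN1r x) -(mulN1r y) Ghom normrN1 mul1r.
(* These are the left difference quotients of t |-> G t 1 at 0. By convexity they lie below the
   right ones, so their supremum is the slope of a supporting line. *)
pose Q := [set (N2 - G (- s) 1) / s | s in [set s | 0 < s]].
have Qle s t : 0 < s -> 0 < t -> (N2 - G (- s) 1) / s <= (G t 1 - N2) / t.
  move=> s0 t0; rewrite ler_pdivrMr // mulrAC ler_pdivlMr //.
  have := Gadd (s * t) (s * 1) (t * - s) (t * 1).
  rewrite (Gpos s _ _ (ltW s0)) (Gpos t _ _ (ltW t0)) (_ : s * t + t * - s = 0); last by ring.
  by rewrite !mulr1 G01 ?addr_ge0 ?(ltW s0) ?(ltW t0) //; lra.
have supQ : has_sup Q.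
  split; first by exists ((N2 - G (- 1) 1) / 1); exists 1 => //=.
  by exists ((G 1 1 - N2) / 1) => _ [s s0 <-]; exact: Qle.
pose a := sup Q.
have sub t : N2 + a * t <= G t 1.
  have [t0|t0|->] := ltgtP t 0.
  - have : (N2 - G t 1) / - t <= a.
      by apply: ub_le_sup; [exact: supQ.2|exists (- t); rewrite /= ?oppr_gt0 // opprK].
    rewrite ler_pdivrMr ?oppr_gt0 //; lra.
  - have : a <= (G t 1 - N2) / t by apply: ge_sup; [exact: supQ.1|move=> _ [s s0 <-]; exact: Qle].
    rewrite ler_pdivlMr //; lra.
  - by rewrite mulr0 addr0.
have supp2 x y : a * x + N2 * y <= G x y.
  (* Homogeneity extends the support from the line y = 1 to y > 0 only. Adding (0, S), where the
     support is an equality, moves any point there, and the extra term S N2 cancels. *)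
  pose S := `|y| + 1.
  have S0 : 0 <= S by rewrite addr_ge0.
  have yS : 0 < y + S by have := ler_norm (- y); rewrite normrN /S; lra.
  have E : G x (y + S) = (y + S) * G (x / (y + S)) 1.
    by rewrite -Gpos ?(ltW yS) // mulr1 mulrC divfK // gt_eqF.
  have := Gadd x y 0 S; rewrite addr0 (G01 _ S0) E.
  have : (y + S) * (N2 + a * (x / (y + S))) <= (y + S) * G (x / (y + S)) 1.
    by rewrite ler_wpM2l ?sub // ltW.
  have -> : (y + S) * (N2 + a * (x / (y + S))) = (y + S) * N2 + a * x by field; rewrite gt_eqF.
  lra.
have aN1 : `|a| <= N1.
  rewrite ler_norml; apply/andP; split.
    by have := supp2 (- 1) 0; rewrite -{2}oppr0 GN -/N1; lra.
  by have := supp2 1 0; rewrite -/N1; lra.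
exists a => // x0 y0; split; first exact: supp2.
have abs2 x y : (a * x + N2 * y) ^+ 2 <= G x y ^+ 2.
  have := supp2 x y; have := supp2 (- x) (- y); rewrite GN => h1 h2; nra.
have tang t : N1 - N2 * a / N1 * t <= G 1 t.
  set W := G 1 t; pose D := N1 * (W - N1) + N2 * a * t.
  suff D0 : 0 <= D.
    rewrite -(ler_pM2l N1p) mulrBr.
    have -> : N1 * (N2 * a / N1 * t) = N2 * a * t by field; rewrite gt_eqF.
    move: D0; rewrite /D; lra.
  (* Maximality is applied at the vector (1, e t), with the support at (0, 1) bounding G (- e t) 1
     from below and convexity between (1, 0) and (1, t) bounding G 1 (e t) from above. The terms of
     order 0 in e cancel and 2 D + e L >= 0 remains; small e then forces D >= 0. *)
  pose L := (W - N1) ^+ 2 - t ^+ 2 * (a ^+ 2 - N2 ^+ 2 + N1 ^+ 2).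
  have step e : 0 < e -> e <= 1 -> - (e * L) <= 2 * D.
    move=> e0 e1.
    have h1 : G 1 (e * t) <= (1 - e) * N1 + e * W.
      have := Gadd ((1 - e) * 1) ((1 - e) * 0) (e * 1) (e * t).
      rewrite !Gpos ?subr_ge0 ?(ltW e0) // -/N1 -/W.
      by congr (G _ _ <= _); ring.
    have h0 : 0 <= G 1 (e * t).
      have := Gadd 1 (e * t) (- 1) (- (e * t)); rewrite GN !subrr G01 // mul0r; lra.
    have h2 := Gmax 1 (e * t).
    have h3 := abs2 (- (e * t)) 1.
    have h4 : G 1 (e * t) ^+ 2 <= ((1 - e) * N1 + e * W) ^+ 2.
      by rewrite ler_pXn2r // nnegrE // (le_trans h0).
    rewrite -(ler_pM2l e0); move: h2 h3 h4; rewrite /D /L.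
    move: (G _ _ ^+ 2) (G 1 (e * t) ^+ 2) => A B; nra.
  rewrite leNgt; apply/negP => D0.
  pose e := Num.min 1 (- D / (`|L| + 1)).
  have L1 : 0 < `|L| + 1 by rewrite ltr_wpDl.
  have e0 : 0 < e by rewrite lt_min ltr01 divr_gt0 // oppr_gt0.
  have e1 : e <= 1 by rewrite ge_min lexx.
  have eL : e * (`|L| + 1) <= - D.
    by rewrite -ler_pdivlMr // ge_min lexx orbT.
  have := step e e0 e1; have : e * L <= e * `|L| by rewrite ler_pM2l // ler_norm.
  lra.
pose S := `|x0| + 1.
have S0 : 0 <= S by rewrite addr_ge0.
have xS : 0 < x0 + S by have := ler_norm (- x0); rewrite normrN /S; lra.
have E : G (x0 + S) y0 = (x0 + S) * G 1 (y0 / (x0 + S)).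
  by rewrite -Gpos ?(ltW xS) // mulr1 mulrC divfK // gt_eqF.
have := Gadd x0 y0 S 0; rewrite addr0 (G10 _ S0) E.
have : (x0 + S) * (N1 - N2 * a / N1 * (y0 / (x0 + S))) <= (x0 + S) * G 1 (y0 / (x0 + S)).
  by rewrite ler_wpM2l ?tang // ltW.
have -> : (x0 + S) * (N1 - N2 * a / N1 * (y0 / (x0 + S))) =
   (x0 + S) * N1 - N2 * a / N1 * y0 by field; rewrite !gt_eqF.
lra.
Qed.

Section Gauge.
Context {R : realType} (Om : set (R * R)).
Hypothesis Om_bounded : bounded_set Om.
Hypothesis Om_open : open Om.
Hypothesis Om_convex : convex_set Om.
Hypothesis Om_balanced : balanced Om.
Hypothesis Om_nonempty : Om !=set0.

Lemma convex_setP2 (x y : R * R) (t : R) : Om x -> Om y -> 0 <= t <= 1 ->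
  Om (t * x.1 + (1 - t) * y.1, t * x.2 + (1 - t) * y.2).
Proof.
move=> Ox Oy /andP[t0 t1].
by have /set_mem := Om_convex (Itv01 t0 t1) (mem_set Ox) (mem_set Oy).
Qed.

Lemma open_box x : Om x -> exists2 e : R, 0 < e &
  forall z, `|z.1 - x.1| < e -> `|z.2 - x.2| < e -> Om z.
Proof.
move=> Ox; have /nbhs_ballP[e /= e0 eO] : nbhs x Om by exact: open_nbhs_nbhs.
exists e => // z z1 z2; apply: eO; split; rewrite /ball /= distrC //.
Qed.

Let Om0 : Om (0, 0).
Proof.
have [x Ox] := Om_nonempty; have := convex_setP2 (t := 2^-1) Ox (Om_balanced Ox).
rewrite invr_ge0 ler0n invf_le1 // ler1n => /(_ isT) /=.
by congr (Om (_, _)); field.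
Qed.

Let star s x : Om x -> 0 <= s <= 1 -> Om (s * x.1, s * x.2).
Proof. by move=> Ox s01; have := convex_setP2 Ox Om0 s01; rewrite /= !mulr0 !addr0. Qed.

Let dil (x : R * R) := [set t : R | 0 < t /\ Om (t^-1 * x.1, t^-1 * x.2)].
Let N (x : R * R) : R := inf (dil x).

Let dil_lb x : has_lbound (dil x).
Proof. by exists 0 => t [/ltW]. Qed.

Let dil_nonempty x : dil x !=set0.
Proof.
have [e e0 eO] := open_box Om0; pose s := `|x.1| + `|x.2| + 1.
have [n1 n2] := (normr_ge0 x.1, normr_ge0 x.2).
have s0 : 0 < s by rewrite /s; lra.
exists (s / e); split; first by rewrite divr_gt0.
apply: eO; rewrite /= subr0 invf_div normrM ger0_norm ?divr_ge0 ?(ltW e0) ?(ltW s0) //.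
  by rewrite mulrAC ltr_pdivrMr // ltr_pM2l // /s; lra.
by rewrite mulrAC ltr_pdivrMr // ltr_pM2l // /s; lra.
Qed.

Let N_ge0 x : 0 <= N x.
Proof. by apply: lb_le_inf; [exact: dil_nonempty|move=> t [/ltW]]. Qed.

Let N_le x t : 0 < t -> Om (t^-1 * x.1, t^-1 * x.2) -> N x <= t.
Proof. by move=> t0 Ot; apply: ge_inf; [exact: dil_lb|split]. Qed.

Let N_lt x t : N x < t -> Om (t^-1 * x.1, t^-1 * x.2).
Proof.
move=> /(inf_lt (dil_nonempty x))[s [s0 Os] st].
have t0 := lt_trans s0 st.
have := star (s := s / t) Os; rewrite divr_ge0 ?(ltW s0) ?(ltW t0) //.
rewrite ler_pdivrMr // mul1r (ltW st) => /(_ isT) /=.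
by congr (Om (_, _)); field; rewrite !gt_eqF.
Qed.

(** Openness leaves room to dilate [x] by 1 + d, which makes the inequality strict; this is where
    the strict bounds on the strips come from. *)
Let N_Om x : Om x -> N x < 1.
Proof.
move=> Ox; have [e e0 eO] := open_box Ox; pose s := `|x.1| + `|x.2| + 1.
have [n1 n2] := (normr_ge0 x.1, normr_ge0 x.2).
have s0 : 0 < s by rewrite /s; lra.
pose d := e / s; have d0 : 0 < d by rewrite divr_gt0.
have ds : d * s = e by rewrite divfK // gt_eqF.
have d1 : 0 < 1 + d by rewrite addr_gt0.
apply: (@le_lt_trans _ _ ((1 + d)^-1)); last by rewrite invf_lt1 // ltrDl.
apply: N_le; first by rewrite invr_gt0.
rewrite invrK; apply: eO => /=.
  have -> : (1 + d) * x.1 - x.1 = d * x.1 by ring.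
  by rewrite normrM gtr0_norm // -ds ltr_pM2l // /s; lra.
have -> : (1 + d) * x.2 - x.2 = d * x.2 by ring.
by rewrite normrM gtr0_norm // -ds ltr_pM2l // /s; lra.
Qed.

Let N_lt1 x : N x < 1 -> Om x.
Proof. by move=> /N_lt; rewrite invr1 !mul1r -surjective_pairing. Qed.

Let N_add x y : N (x.1 + y.1, x.2 + y.2) <= N x + N y.
Proof.
apply/ler_addgt0Pr => e e0.
have e2 : 0 < e / 2 by rewrite divr_gt0.
have s0 : 0 < N x + e / 2 by rewrite ltr_wpDl // N_ge0.
have t0 : 0 < N y + e / 2 by rewrite ltr_wpDl // N_ge0.
have Os : Om ((N x + e / 2)^-1 * x.1, (N x + e / 2)^-1 * x.2) by apply: N_lt; rewrite ltrDl.
have Ot : Om ((N y + e / 2)^-1 * y.1, (N y + e / 2)^-1 * y.2) by apply: N_lt; rewrite ltrDl.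
have -> : N x + N y + e = (N x + e / 2) + (N y + e / 2) by lra.
move: (N x + e / 2) (N y + e / 2) s0 t0 Os Ot => s t s0 t0 Os Ot.
have st : 0 < s + t by rewrite addr_gt0.
apply: N_le => //=.
have := convex_setP2 (t := s / (s + t)) Os Ot.
rewrite divr_ge0 ?(ltW s0) ?(ltW st) // ler_pdivrMr // mul1r lerDl (ltW t0) => /(_ isT) /=.
by congr (Om (_, _)); field; rewrite !gt_eqF.
Qed.

Let N_scale_le c x : 0 < c -> N (c * x.1, c * x.2) <= c * N x.
Proof.
move=> c0; rewrite -ler_pdivrMl //; apply/ler_addgt0Pr => e e0.
rewrite ler_pdivrMl //.
have t0 : 0 < N x + e by rewrite ltr_wpDl // N_ge0.
apply: N_le; first by rewrite mulr_gt0.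
have : Om ((N x + e)^-1 * x.1, (N x + e)^-1 * x.2) by apply: N_lt; rewrite ltrDl.
by congr (Om (_, _)); rewrite /=; field; rewrite !gt_eqF.
Qed.

Let N_opp x : N (- x.1, - x.2) = N x.
Proof.
congr inf; apply/seteqP; split => t [t0 Ot]; split => //.
  by have := Om_balanced Ot; rewrite /= !mulrN; congr (Om (_, _)); rewrite opprK.
by rewrite /= !mulrN; exact: Om_balanced Ot.
Qed.

Let N_scale c x : N (c * x.1, c * x.2) = `|c| * N x.
Proof.
have pos d : 0 < d -> N (d * x.1, d * x.2) = d * N x.
  move=> d0; apply: le_anti; rewrite N_scale_le //= -ler_pdivlMl //.
  have := N_scale_le (c := d^-1) (d * x.1, d * x.2); rewrite invr_gt0 d0 => /(_ isT) /=.
  by rewrite !mulKf ?gt_eqF // -surjective_pairing.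
have [c0|c0|->] := ltgtP c 0.
- rewrite ltr0_norm // -pos ?oppr_gt0 // -[RHS]N_opp /=.
  by congr (N (_, _)); ring.
- by rewrite gtr0_norm // pos.
- rewrite normr0 !mul0r; apply: le_anti; rewrite N_ge0 andbT.
  apply/ler_addgt0Pr => e e0; rewrite add0r; apply: N_le => //=.
  by rewrite !mulr0.
Qed.

Let N_pos x : x != (0, 0) -> 0 < N x.
Proof.
move=> x0; have [M M0 OM] := bounded_setP2 Om_bounded.
have m0 : 0 < Num.max `|x.1| `|x.2|.
  rewrite lt_max !normr_gt0 -negb_and; apply: contra x0.
  by case: x => a b /= /andP[/eqP -> /eqP ->].
apply: (@lt_le_trans _ _ (Num.max `|x.1| `|x.2| / M)); first by rewrite divr_gt0.
apply: lb_le_inf; first exact: dil_nonempty.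
move=> t [t0 /OM /= []].
rewrite !normrM ger0_norm ?invr_ge0 ?(ltW t0) // !ler_pdivrMl // => h1 h2.
by rewrite ler_pdivrMr // ge_max h1.
Qed.

Let N_bound : exists2 C : R, 0 < C & forall x, N x <= C * (`|x.1| + `|x.2|).
Proof.
exists (N (1, 0) + N (0, 1)) => [|x].
  by rewrite addr_gt0 ?N_pos // xpair_eqE oner_eq0 ?andbF.
have := N_add (x.1 * 1, x.1 * 0) (x.2 * 0, x.2 * 1).
rewrite /= (N_scale x.1 (1, 0)) (N_scale x.2 (0, 1)) !mulr0 !mulr1 add0r addr0 -surjective_pairing.
have := N_ge0 (1, 0); have := N_ge0 (0, 1).
have := normr_ge0 x.1; have := normr_ge0 x.2; nra.
Qed.

Let N_lip x y : N x - N y <= N (x.1 - y.1, x.2 - y.2).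
Proof.
by have := N_add (x.1 - y.1, x.2 - y.2) y; rewrite /= !subrK -surjective_pairing; lra.
Qed.

Let N_continuous : continuous N.
Proof.
have [C C0 NC] := N_bound; move=> x; apply/cvgrPdist_lt => e e0.
have d0 : 0 < e / (2 * C) by rewrite divr_gt0 // mulr_gt0.
apply: filterS (nbhsx_ballx (x : R * R) _ d0) => y [y1 y2].
rewrite /ball /= in y1 y2.
have h : C * (`|x.1 - y.1| + `|x.2 - y.2|) < e.
  have -> : e = C * (e / (2 * C) + e / (2 * C)) by field; rewrite gt_eqF.
  by rewrite ltr_pM2l // ltrD.
have := NC (x.1 - y.1, x.2 - y.2); have := N_lip x y; have := N_lip y x.
have := N_opp (x.1 - y.1, x.2 - y.2); rewrite /= !opprB => -> h1 h2 h3.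
by rewrite ltr_norml; apply/andP; split; lra.
Qed.

Let circle := [set z : R * R | z.1 ^+ 2 + z.2 ^+ 2 = 1].

Let circle_compact : compact circle.
Proof.
pose I : set R := `[-1, 1]%classic.
apply: (@subclosed_compact _ _ (I `*` I)).
- have -> : circle = (fun z : R * R => z.1 ^+ 2 + z.2 ^+ 2) @^-1` [set 1] by [].
  apply: closed_comp; last exact: closed_eq.
  move=> z _; apply: cvgD.
    exact: (continuous_comp (f := fst) (g := fun x : R => x ^+ 2) cvg_fst (@exprn_continuous R 2 _)).
  exact: (continuous_comp (f := snd) (g := fun x : R => x ^+ 2) cvg_snd (@exprn_continuous R 2 _)).
- by apply: compact_setX; exact: segment_compact.
- move=> z; rewrite /circle /I /= !in_itv /= => z1.
  have h (x y : R) : x ^+ 2 + y ^+ 2 = 1 -> -1 <= x <= 1.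
    by move=> xy; rewrite -ler_norml -(@ler_pXn2r _ 2) ?nnegrE // expr1n real_normK ?num_real // -xy lerDl sqr_ge0.
  by split; [exact: h z1|apply: (h _ z.1); rewrite addrC].
Qed.

Lemma conjugate_frame : exists c s p q m : R,
  [/\ c ^+ 2 + s ^+ 2 = 1, 0 < p, 0 < q & `|m| <= 1] /\
  (forall X Y, `|X| + `|Y| < 1 -> Om (X / p * c - Y / q * s, X / p * s + Y / q * c)) /\
  (forall z, Om z ->
     `|p * (c * z.1 + s * z.2) - m * (q * (c * z.2 - s * z.1))| < 1 /\
     `|q * (c * z.2 - s * z.1) + m * (p * (c * z.1 + s * z.2))| < 1).
Proof.
pose F (z : R * R) := N (- z.2, z.1) ^+ 2 - N z ^+ 2.
have cF : continuous F.
  have cJ : continuous (fun z : R * R => (- z.2, z.1)).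
    move=> z; have h1 : (- z'.2) @[z' --> z] --> - z.2 by apply: cvgN; exact: cvg_snd.
    have h2 : z'.1 @[z' --> z] --> z.1 by exact: cvg_fst.
    exact: (cvg_pair h1 h2).
  move=> z; apply: cvgB.
    apply: (continuous_comp (f := fun z : R * R => N (- z.2, z.1)) (g := fun x : R => x ^+ 2)); last exact: exprn_continuous.
    by apply: (continuous_comp (f := fun z : R * R => (- z.2, z.1)) (g := N)); [exact: cJ|exact: N_continuous].
  by apply: (continuous_comp (f := N) (g := fun x : R => x ^+ 2)); [exact: N_continuous|exact: exprn_continuous].
have [e /set_mem e1 emax] : exists2 e, e \in circle & forall z, z \in circle -> F z <= F e.
  apply: compact_EVT_max; [by exists (1, 0); rewrite /circle /= expr1n expr0n addr0|exact: circle_compact|].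
  exact: continuous_subspaceT.
case: e e1 emax => c s; rewrite /circle /= => cs emax.
(* [F] is homogeneous of degree 2, so its maximum on the circle becomes a quadratic bound on the
   whole plane, the form in which [norm_conjugate_frame] takes the extremality. *)
have Fmax z : F z <= F (c, s) * (z.1 ^+ 2 + z.2 ^+ 2).
  have [z0|z0] := eqVneq (z.1 ^+ 2 + z.2 ^+ 2) 0.
    have [z1 z2] : z.1 = 0 /\ z.2 = 0.
      by move/eqP: z0; rewrite paddr_eq0 ?sqr_ge0 // !sqrf_eq0 => /andP[/eqP -> /eqP ->].
    have N00 : N (0, 0) = 0 by have := N_scale 0 (0, 0); rewrite /= mulr0 normr0 mul0r.
    have -> : z = (0, 0) by case: z z1 z2 {z0} => ? ? /= -> ->.
    by rewrite /F /= oppr0 N00 subrr expr0n /= addr0 mulr0.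
  have zp : 0 < z.1 ^+ 2 + z.2 ^+ 2 by rewrite lt_neqAle eq_sym z0 addr_ge0 ?sqr_ge0.
  pose r := Num.sqrt (z.1 ^+ 2 + z.2 ^+ 2).
  have r0 : 0 < r by rewrite sqrtr_gt0.
  have rr : r ^+ 2 = z.1 ^+ 2 + z.2 ^+ 2 by rewrite sqr_sqrtr // ltW.
  have := emax (r^-1 * z.1, r^-1 * z.2); rewrite inE /= !exprMn -mulrDr -rr -exprMn mulVf ?gt_eqF // expr1n => /(_ erefl).
  rewrite -(ler_pM2r (exprn_gt0 2 r0)) rr; apply: le_trans.
  have := N_scale r^-1 (- z.2, z.1); rewrite /= mulrN => E1.
  rewrite /F /= E1 (N_scale r^-1 z) gtr0_norm ?invr_gt0 //.
  by rewrite !exprMn -mulrBr -rr mulrAC -exprMn mulVf ?gt_eqF // expr1n mul1r.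
(* The gauge in the coordinates of the extremal frame e1 = (c, s), e2 = (- s, c). *)
pose G x y := N (x * c - y * s, x * s + y * c).
have G10 : G 1 0 = N (c, s) by rewrite /G; congr (N (_, _)); ring.
have G01 : G 0 1 = N (- s, c) by rewrite /G; congr (N (_, _)); ring.
have cs0 : (c, s) != (0, 0).
  by apply/eqP => -[c0 s0]; move: cs; rewrite c0 s0 expr0n addr0 => /eqP; rewrite eq_sym oner_eq0.
have sc0 : (- s, c) != (0, 0).
  by apply: contra cs0; rewrite !xpair_eqE oppr_eq0 andbC.
have [||||| a aN ga] := @norm_conjugate_frame R G.
- move=> x y x' y'; rewrite /G; apply: le_trans (N_add _ _); rewrite /=.
  by rewrite le_eqVlt; apply/orP; left; apply/eqP; congr (N (_, _)); ring.
- by move=> k x y; rewrite -[in RHS](N_scale k) /G; congr (N (_, _)); rewrite /=; ring.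
- by rewrite G10 N_pos.
- by rewrite G01 N_pos.
- move=> x y; rewrite G10 G01 /G; have := Fmax (x * c - y * s, x * s + y * c).
  rewrite /F /= (_ : (x * c - y * s) ^+ 2 + (x * s + y * c) ^+ 2 = (c ^+ 2 + s ^+ 2) * (x ^+ 2 + y ^+ 2)); last by ring.
  rewrite cs mul1r; congr (N (_, _) ^+ 2 - _ <= _); ring.
move: aN ga; rewrite G10 G01; set p := N (c, s); set q := N (- s, c) => aN ga.
have p0 : 0 < p by exact: N_pos.
have q0 : 0 < q by exact: N_pos.
exists c, s, p, q, (a / p); split; [split => //|split].
- by rewrite normrM (gtr0_norm (x := p^-1)) ?invr_gt0 // ler_pdivrMr // mul1r.
- move=> X Y XY; apply: N_lt1; apply: le_lt_trans XY.
  have := N_add (X / p * c, X / p * s) (Y / q * - s, Y / q * c).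
  rewrite /= (N_scale (X / p) (c, s)) (N_scale (Y / q) (- s, c)) -/p -/q !normrM mulrN.
  rewrite (gtr0_norm (x := p^-1)) ?invr_gt0 // (gtr0_norm (x := q^-1)) ?invr_gt0 //.
  by rewrite !divfK ?gt_eqF.
- move=> z /N_Om Nz.
  pose x := c * z.1 + s * z.2; pose y := c * z.2 - s * z.1.
  have zE : N z = G x y.
    rewrite [z in LHS]surjective_pairing /G; congr (N (_, _)).
      by rewrite -[LHS]mul1r -cs /x /y; ring.
    by rewrite -[LHS]mul1r -cs /x /y; ring.
  have GN : G (- x) (- y) = G x y.
    by rewrite /G -N_opp /=; congr (N (_, _)); ring.
  have [g1 g2] := ga x y; have [g3 g4] := ga (- x) (- y).
  rewrite zE in Nz; rewrite GN in g3 g4.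
  rewrite -/x -/y.
  have -> : p * x - a / p * (q * y) = p * x - q * a / p * y by ring.
  have -> : q * y + a / p * (p * x) = a * x + q * y by field; rewrite gt_eqF.
  by split; rewrite ltr_norml; apply/andP; split; lra.
Qed.
End Gauge.

(** * The bound on kappa *)

Lemma cos_lipschitz {R : realType} (a b : R) : `|cos a - cos b| <= `|a - b|.
Proof.
wlog ab : a b / a <= b => [wlg|].
  have [|/ltW] := leP a b; first exact: wlg.
  by move=> /wlg; rewrite distrC [`|b - a|]distrC.
have cc : {within `[a, b], continuous (@cos R)}.
  by apply: continuous_subspaceT; exact: continuous_cos.
have [c _] := @MVT_segment R cos (fun x => - sin x) a b ab (fun x _ => is_derive_cos x) cc.
rewrite distrC [`|a - b|]distrC => ->; rewrite normrM normrN ler_piMl //.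
by rewrite ler_norml sin_geN1 sin_le1.
Qed.

(** Since cos is 1-Lipschitz, the integral is Lipschitz in [t] with constant |B| mu(A). *)
Lemma continuous_integral_cos {d} {T : measurableType d} {R : realType}
    (mu : {measure set T -> \bar R}) (A : set T) (g : T -> R) (B : R) :
  measurable A -> (mu A < +oo)%E -> measurable_fun A g ->
  (forall x, A x -> `|g x| <= B) ->
  continuous (fun t : R => \int[mu]_(x in A) cos (t * g x)).
Proof.
move=> mA Aoo mg gB.
have mc t : measurable_fun A (fun x => cos (t * g x)).
  apply: (@measurableT_comp _ _ _ _ _ _ (@cos R)); last exact: measurable_funM.
  exact: continuous_measurable_fun (@continuous_cos R).
have ic t : mu.-integrable A (EFin \o (fun x => cos (t * g x))).
  apply: (integrable_bounded mA Aoo (M := 1)) => // x _.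
  by rewrite ler_norml cos_geN1 cos_le1.
have lip s t : `|\int[mu]_(x in A) cos (s * g x) - \int[mu]_(x in A) cos (t * g x)| <=
    `|s - t| * (`|B| * fine (mu A)).
  rewrite -(RintegralB mA (ic s) (ic t)).
  have iB : mu.-integrable A (EFin \o (fun x => cos (s * g x) - cos (t * g x))).
    by have := integrableB mA (ic s) (ic t); apply: eq_integrable.
  apply: le_trans (le_normr_Rintegral mA iB) _.
  rewrite mulrA -(Rintegral_cst mu mA); apply: (le_Rintegral mA).
  - exact: integrable_norm iB.
  - by apply: (integrable_bounded mA Aoo (M := `| `|s - t| * `|B| |)) => //; exact: measurable_cst.
  - move=> x Ax; apply: le_trans (cos_lipschitz _ _) _.
    rewrite -mulrBl normrM ler_wpM2l //; apply: le_trans (gB x Ax) _; exact: ler_norm.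
move=> t; apply/cvgrPdist_lt => e e0.
pose C := `|B| * fine (mu A) + 1.
have C0 : 0 < C by rewrite ltr_wpDl // mulr_ge0 // fine_ge0.
have d0 : 0 < e / C by rewrite divr_gt0.
apply: filterS (nbhsx_ballx t _ d0) => s; rewrite /ball /= => ts.
apply: le_lt_trans (lip t s) _.
apply: (@le_lt_trans _ _ (`|t - s| * C)); first by rewrite ler_wpM2l // lerDl.
by rewrite -ltr_pdivlMr.
Qed.

Section KappaBound.
Context {R : realType} (Om : set (R * R)).
Hypothesis Om_bounded : bounded_set Om.
Hypothesis Om_open : open Om.
Hypothesis Om_balanced : balanced Om.

Let mOm : measurable (Om : set (P2 R)).
Proof. exact: open_measurable2. Qed.

Let mdot xi : measurable_fun setT (dot xi : P2 R -> R).
Proof. by apply: measurable_funD; exact: measurable_funM. Qed.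

Let dotB (xi : R * R) : exists B : R, forall x, Om x -> `|dot xi x| <= B.
Proof.
have [M M0 OM] := bounded_setP2 Om_bounded.
exists ((`|xi.1| + `|xi.2|) * M) => x /OM [x1 x2].
rewrite /dot (le_trans (ler_normD _ _)) // !normrM mulrDl lerD // ler_wpM2l //.
Qed.

Let Om_oo : (leb2 R Om < +oo)%E.
Proof. by have [M _ OM] := bounded_setP2 Om_bounded; exact: bounded_leb2_lty mOm OM. Qed.

(** Reflection through the origin gives S = - k S with k > 0, hence S = 0 whatever [k] is. *)
Lemma balanced_integral_sin xi : \int[leb2 R]_(x in Om) sin (dot xi x) = 0.
Proof.
have det : (-1 : R) * -1 - 0 * 0 != 0 by rewrite mulrNN mulr1 mulr0 subr0 oner_neq0.
have [k k0 kE] := integral_linmap det.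
have ms : measurable_fun setT ((fun x => sin (dot xi x)) : P2 R -> R).
  apply: (@measurableT_comp _ _ _ _ _ _ (@sin R)); last exact: mdot.
  exact: continuous_measurable_fun (@continuous_sin R).
have LE x : linmap (-1) 0 0 (-1) x = - x :> R * R.
  by case: x => a b; rewrite /linmap /= !mulN1r !mul0r addr0 add0r.
have pre : linmap (-1) 0 0 (-1) @^-1` Om = Om.
  apply/seteqP; split => x /=; rewrite LE => Ox; last exact: Om_balanced.
  by rewrite -(opprK x); exact: Om_balanced.
have is_ : (leb2 R).-integrable Om (EFin \o (fun x => sin (dot xi x))).
  apply: (integrable_bounded mOm Om_oo (M := 1)); first exact: measurable_funTS.
  by move=> x _; rewrite ler_norml sin_geN1 sin_le1.
have oddE x : sin (dot xi (linmap (-1) 0 0 (-1) x)) = -1 * sin (dot xi x).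
  by rewrite LE mulN1r -sinN; congr sin; rewrite /dot /=; ring.
have E := kE Om _ mOm ms; rewrite pre in E.
have iN : (leb2 R).-integrable Om (EFin \o (fun x => -1 * sin (dot xi x))).
  by have := integrableZl mOm (-1) is_; apply: eq_integrable.
have iE : (EFin \o ((fun x => sin (dot xi x)) \o linmap (-1) 0 0 (-1))) = (EFin \o (fun x => -1 * sin (dot xi x))).
  by apply/funext => x /=; rewrite oddE.
rewrite iE in E; have {}E := E iN.
rewrite [X in _ = k * X](@eq_Rintegral _ _ _ (leb2 R) _ (fun x => -1 * sin (dot xi x))) in E; last by move=> x _; exact: oddE.
rewrite (RintegralZl _ mOm is_) in E.
by move: E; move: (\int[_]_(x in _) _) => S; nra.
Qed.

(* The Fourier transform is real by balance, and positive at the origin, so it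
   vanishes somewhere on the segment from 0 to [xi]. *)
Lemma kappa_le_nonpos xi : \int[leb2 R]_(x in Om) cos (dot xi x) <= 0 ->
  (kappa Om <= (eucl_norm xi)%:E)%E.
Proof.
move=> F1; have [B dB] := dotB xi.
pose F t : R := \int[leb2 R]_(x in Om) cos (t * dot xi x).
have cF : continuous F.
  exact: (continuous_integral_cos mOm Om_oo (measurable_funTS (mdot xi)) dB).
have F0 : 0 <= F 0.
  by apply: Rintegral_ge0 => x _; rewrite mul0r cos0.
have {}F1 : F 1 <= 0.
  by move: F1; rewrite /F; under eq_Rintegral do rewrite -(mul1r (dot _ _)).
have [t] := @IVT R F 0 1 0 ler01 (continuous_subspaceT cF)
  ltac:(by rewrite ge_min F1 orbT le_max F0).
rewrite in_itv /= => /andP[t0 t1] Ft.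
apply: (@le_trans _ _ (eucl_norm (t * xi.1, t * xi.2))%:E).
  apply: ereal_inf_lbound; exists (t * xi.1, t * xi.2) => //.
  rewrite /Defs.null_set /= /fourier_indic balanced_integral_sin.
  rewrite (_ : \int[leb2 R]_(x in Om) cos _ = 0) // -[RHS]Ft /F.
  by apply: eq_Rintegral => x _; congr cos; rewrite /dot /=; ring.
rewrite lee_fin /eucl_norm ler_wsqrtr // /dot /=.
have : t * t <= 1 by rewrite mulr_ile1.
have := sqr_ge0 xi.1; have := sqr_ge0 xi.2; rewrite !expr2; nra.
Qed.

Lemma kappa_le_frame (c s p q m : R) : convex_set Om ->
  c ^+ 2 + s ^+ 2 = 1 -> 0 < p -> 0 < q -> `|m| <= 1 ->
  (forall X Y, `|X| + `|Y| < 1 -> Om (X / p * c - Y / q * s, X / p * s + Y / q * c)) ->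
  (forall z, Om z ->
     `|p * (c * z.1 + s * z.2) - m * (q * (c * z.2 - s * z.1))| < 1 /\
     `|q * (c * z.2 - s * z.1) + m * (p * (c * z.1 + s * z.2))| < 1) ->
  (kappa Om <= (pi * Num.sqrt (p ^+ 2 + q ^+ 2))%:E)%E.
Proof.
move=> Om_convex cs p0 q0 m1 Om_sq Om_strip; have pi0 := pi_gt0 R.
have p_neq0 : p != 0 by rewrite gt_eqF.
have q_neq0 : q != 0 by rewrite gt_eqF.
(* The columns are (e1 / p + e2 / q) / 2 and (e1 / p - e2 / q) / 2, so [L] is the inverse of x |->
   (X + Y, X - Y). *)
pose A11 := (c / p - s / q) / 2; pose A12 := (c / p + s / q) / 2.
pose A21 := (s / p + c / q) / 2; pose A22 := (s / p - c / q) / 2.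
have det : A11 * A22 - A12 * A21 != 0.
  have -> : A11 * A22 - A12 * A21 = - (c ^+ 2 + s ^+ 2) / (2 * p * q).
    by rewrite /A11 /A12 /A21 /A22; field; rewrite p_neq0 q_neq0.
  by rewrite cs mulf_neq0 ?oppr_eq0 ?oner_eq0 // invr_eq0 !mulf_neq0 // pnatr_eq0.
pose L := linmap A11 A12 A21 A22.
have LE u v : L (u, v) = ((u + v) / 2 / p * c - (u - v) / 2 / q * s,
    (u + v) / 2 / p * s + (u - v) / 2 / q * c).
  by rewrite /L /linmap /A11 /A12 /A21 /A22 /=; congr pair; field; rewrite p_neq0 q_neq0.
have XE u v : p * (c * (L (u, v)).1 + s * (L (u, v)).2) = (u + v) / 2.
  transitivity ((c ^+ 2 + s ^+ 2) * ((u + v) / 2)); last by rewrite cs mul1r.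
  by rewrite LE /=; field; rewrite p_neq0 q_neq0.
have YE u v : q * (c * (L (u, v)).2 - s * (L (u, v)).1) = (u - v) / 2.
  transitivity ((c ^+ 2 + s ^+ 2) * ((u - v) / 2)); last by rewrite cs mul1r.
  by rewrite LE /=; field; rewrite p_neq0 q_neq0.
have [k k0 kE] := integral_linmap det.
pose K : set (P2 R) := L @^-1` Om.
have mK : measurable K by exact: measurable_linmap_preimage.
have [M M0 OM] := bounded_setP2 Om_bounded.
have tK : tilted_body (4 * (p + q) * M) m K.
  have lin a b z : Om z -> a ^+ 2 <= 1 -> b ^+ 2 <= 1 -> `|a * z.1 + b * z.2| <= 2 * M.
    move=> /OM [z1 z2] a1 b1; have h x : x ^+ 2 <= 1 -> `|x| <= 1 :> R.
      by move=> x1; rewrite -(@ler_pXn2r _ 2) ?nnegrE // expr1n real_normK ?num_real.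
    rewrite (le_trans (ler_normD _ _)) // !normrM.
    have := h a a1; have := h b b1; have := normr_ge0 a; have := normr_ge0 b.
    have := normr_ge0 z.1; have := normr_ge0 z.2; nra.
  have c1 : c ^+ 2 <= 1 by rewrite -cs lerDl sqr_ge0.
  have s1 : s ^+ 2 <= 1 by rewrite -cs lerDr sqr_ge0.
  split => //.
  - move=> [u v] Kuv; have h1 := lin c s _ Kuv c1 s1.
    have h2 := lin (- s) c _ Kuv ltac:(by rewrite sqrrN) c1.
    have uE := XE u v; have vE := YE u v.
    have b1 : `|(u + v) / 2| <= p * (2 * M).
      by rewrite -uE normrM gtr0_norm // ler_pM2l.
    have b2 : `|(u - v) / 2| <= q * (2 * M).
      by rewrite -vE normrM gtr0_norm // ler_pM2l // addrC -mulNr.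
    move: b1 b2; rewrite !ler_norml /= => /andP[? ?] /andP[? ?].
    have pM := mulr_gt0 p0 M0; have qM := mulr_gt0 q0 M0.
    by split; apply/andP; split; lra.
  - move=> x y t Kx Ky t01; have := convex_setP2 Om_convex Kx Ky t01.
    by rewrite /K /L /linmap /=; congr (Om (_, _)); ring.
  - move=> u v u1 v1; rewrite /K /= LE; apply: Om_sq.
    move: u1 v1; rewrite !ltr_norml => /andP[? ?] /andP[? ?].
    by case: (ger0P ((u + v) / 2)) => _; case: (ger0P ((u - v) / 2)) => _; lra.
  - move=> u v /Om_strip []; rewrite XE YE => h _; move: h; rewrite ltr_norml => /andP[? ?].
    by rewrite ler_norml; apply/andP; split; lra.
  - move=> u v /Om_strip []; rewrite XE YE => _ h; move: h; rewrite ltr_norml => /andP[? ?].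
    by rewrite ler_norml; apply/andP; split; lra.
(* These are pi (p e1 + q e2) and pi (p e1 - q e2): paired with x they give pi u and pi v, and
   orthogonality makes their lengths equal. *)
pose xi1 : R * R := (pi * (p * c - q * s), pi * (p * s + q * c)).
pose xi2 : R * R := (pi * (p * c + q * s), pi * (p * s - q * c)).
have norm1 : eucl_norm xi1 = pi * Num.sqrt (p ^+ 2 + q ^+ 2).
  rewrite /eucl_norm; have -> : dot xi1 xi1 = pi ^+ 2 * (p ^+ 2 + q ^+ 2).
    rewrite -[RHS]mulr1 -cs /dot /=; ring.
  by rewrite sqrtrM ?sqr_ge0 // sqrtr_sqr gtr0_norm.
have norm2 : eucl_norm xi2 = pi * Num.sqrt (p ^+ 2 + q ^+ 2).
  rewrite /eucl_norm; have -> : dot xi2 xi2 = pi ^+ 2 * (p ^+ 2 + q ^+ 2).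
    rewrite -[RHS]mulr1 -cs /dot /=; ring.
  by rewrite sqrtrM ?sqr_ge0 // sqrtr_sqr gtr0_norm.
have mcos xi : measurable_fun setT ((fun x => cos (dot xi x)) : P2 R -> R).
  apply: (@measurableT_comp _ _ _ _ _ _ (@cos R)); last exact: mdot.
  exact: continuous_measurable_fun (@continuous_cos R).
have icos xi : (leb2 R).-integrable Om (EFin \o (fun x => cos (dot xi x))).
  apply: (integrable_bounded mOm Om_oo (M := 1)); first exact: measurable_funTS.
  by move=> x _; rewrite ler_norml cos_geN1 cos_le1.
have sum_le0 : \int[leb2 R]_(x in Om) cos (dot xi1 x) + \int[leb2 R]_(x in Om) cos (dot xi2 x) <= 0.
  rewrite -(RintegralD mOm (icos xi1) (icos xi2)).
  have KM := tilted_bounded tK.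
  have fE z : cos (dot xi1 (L z)) + cos (dot xi2 (L z)) = cos (pi * z.1) + cos (pi * z.2).
    case: z => u v; have uE := XE u v; have vE := YE u v.
    have -> : dot xi1 (L (u, v)) = pi * u.
      transitivity (pi * ((u + v) / 2 + (u - v) / 2)); last by congr (_ * _); field.
      by rewrite -uE -vE /dot /=; ring.
    have -> // : dot xi2 (L (u, v)) = pi * v.
    transitivity (pi * ((u + v) / 2 - (u - v) / 2)); last by congr (_ * _); field.
    by rewrite -uE -vE /dot /=; ring.
  rewrite kE //; first last.
  - have -> : ((fun x : P2 R => cos (dot xi1 x) + cos (dot xi2 x)) \o linmap A11 A12 A21 A22) =
        (fun z : P2 R => cos (pi * z.1) + cos (pi * z.2)) by apply/funext => z; exact: fE.
    apply: (integrable_bounded mK (bounded_leb2_lty mK KM) (M := 2)).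
      apply: measurable_funTS.
      apply: measurable_funD; apply: (@measurableT_comp _ _ _ _ _ _ (@cos R));
        try exact: measurable_funM; exact: continuous_measurable_fun (@continuous_cos R).
    move=> z _; rewrite (le_trans (ler_normD _ _)) // -[leRHS]/(1 + 1) lerD //;
    by rewrite ler_norml cos_geN1 cos_le1.
  - exact: measurable_funD.
  rewrite mulr_ge0_le0 ?(ltW k0) //.
  apply: le_trans (tilted_integral_le0 tK).
  by rewrite le_eqVlt; apply/orP; left; apply/eqP; apply: eq_Rintegral => z _; exact: fE.
have [F1|F1] := leP (\int[leb2 R]_(x in Om) cos (dot xi1 x)) 0.
  by rewrite -norm1; exact: kappa_le_nonpos.
rewrite -norm2; apply: kappa_le_nonpos.
by apply: le_trans sum_le0; rewrite lerDr (ltW F1).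
Qed.
End KappaBound.

(** * The Poincare inequality *)

Lemma segment_integrable {R : realType} (f : R -> R) (a b : R) : a < b ->
  (forall x, a <= x <= b -> {for x, continuous f}) ->
  lebesgue_measure.-integrable (`[a, b] : set (measurableTypeR R)) (EFin \o f).
Proof.
move=> ab cf; apply: continuous_compact_integrable; first exact: segment_compact.
by apply: continuous_in_subspaceT => x /set_mem /=; rewrite in_itv /= => /cf.
Qed.

(* For [w x = - k * tan (k * x)] one has
   [f'^2 - k^2 f^2 = (f' - w f)^2 + (f^2 w)']; the inequality [k < pi / 2] keeps
   [w] smooth up to the endpoints. *)
Lemma poincare_segment {R : realType} (f f' : R -> R) (k : R) : 0 <= k < pi / 2 ->
  (forall x, is_derive x (1 : R) f (f' x)) -> continuous f' ->
  f (-1) = 0 -> f 1 = 0 ->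
  0 <= \int[lebesgue_measure]_(x in `[-1, 1]) (f' x ^+ 2 - k ^+ 2 * f x ^+ 2).
Proof.
move=> /andP[k0 kpi] df cf' fN1 f1.
have ab : -1 < 1 :> R by rewrite (lt_trans (ltrN10 R)) // ltr01.
have cosk (x : R) : -1 <= x <= 1 -> cos (k * x) != 0.
  move=> /andP[? ?]; rewrite gt_eqF // cos_gt0_pihalf //.
  have : `|k * x| <= k by rewrite normrM ger0_norm // ler_piMr // ler_norml; apply/andP.
  by rewrite ler_norml => /andP[? ?]; apply/andP; split; lra.
have cf : continuous f.
  by move=> x; apply/differentiable_continuous/derivable1_diffP; have [] := df x.
pose w (x : R) : R := - k * tan (k * x).
pose G x := f x ^+ 2 * w x.
pose g x := 2 * f x * f' x * w x - f x ^+ 2 * (k ^+ 2 + w x ^+ 2).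
(* This Riccati equation for [w] is what completes the square in the final comparison of
   integrands. *)
have dw (x : R) : -1 <= x <= 1 -> is_derive x (1 : R) w (- (k ^+ 2 + w x ^+ 2)).
  move=> /cosk kx; have := @is_derive_tan R _ kx; rewrite cos2_tan2 // => dt.
  have dk : is_derive x (1 : R) ( *%R k) k.
    by apply: is_derive_eq; rewrite /GRing.scale /= mulr1.
  have dc := is_derive1_comp dt dk.
  rewrite /w; apply: is_derive_eq; rewrite /GRing.scale /=; ring.
have dG (x : R) : -1 <= x <= 1 -> is_derive x (1 : R) G (g x).
  move=> /dw dwx; have dfx := df x.
  by rewrite /G /g; apply: is_derive_eq; rewrite /GRing.scale /=; ring.
have cw (x : R) : -1 <= x <= 1 -> {for x, continuous w}.
  by move=> /dw[dwx _]; apply/differentiable_continuous/derivable1_diffP.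
have cg (x : R) : -1 <= x <= 1 -> {for x, continuous g}.
  move=> /cw cwx; apply: cvgB.
    by apply: cvgM cwx; apply: cvgM (cf' x); apply: cvgM (cf x); exact: cvg_cst.
  apply: cvgM; first by rewrite /=; under eq_fun do rewrite expr2; exact: cvgM (cf x) (cf x).
  by apply: cvgD; [exact: cvg_cst|under eq_fun do rewrite expr2; exact: cvgM].
have ch (x : R) : {for x, continuous (fun x => f' x ^+ 2 - k ^+ 2 * f x ^+ 2)}.
  apply: cvgB; first by under eq_fun do rewrite expr2; exact: cvgM (cf' x) (cf' x).
  by apply: cvgM; [exact: cvg_cst|under eq_fun do rewrite expr2; exact: cvgM (cf x) (cf x)].
have -> : 0 = \int[lebesgue_measure]_(x in `[-1, 1]) g x.
  by rewrite (Rintegral_FTC2_within ab dG cg) /G fN1 f1 expr0n /= !mul0r subr0.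
have mI : measurable (`[-1, 1] : set (measurableTypeR R)) by exact: measurable_itv.
have ig := segment_integrable ab cg.
have ih := segment_integrable ab (fun x _ => ch x).
apply: (le_Rintegral mI ig ih) => x _; rewrite /g -subr_ge0.
have -> : f' x ^+ 2 - k ^+ 2 * f x ^+ 2 - (2 * f x * f' x * w x - f x ^+ 2 * (k ^+ 2 + w x ^+ 2)) =
  (f' x - w x * f x) ^+ 2 by ring.
exact: sqr_ge0.
Qed.

Section TestFunction.
Context {R : realType} (Om : set (R * R)).

Lemma test_function_continuous phi : test_function Om phi -> continuous phi.
Proof. by move=> [sphi _ _] x; exact: differentiable_continuous (sphi [::] x). Qed.

Lemma test_function_derivable phi : test_function Om phi -> forall x v : R * R,
  derivable phi x v.
Proof. by move=> [sphi _ _] x v; exact: diff_derivable (sphi [::] x). Qed.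

Lemma test_function_eq0 phi x : test_function Om phi -> ~ Om x -> phi x = 0.
Proof.
move=> [_ _ subOm] Omx; apply/eqP; apply: contra_notT Omx => phix.
by apply: subOm; exact: subset_closure.
Qed.

Lemma test_function_derive phi v : test_function Om phi -> test_function Om ('D_v phi).
Proof.
move=> [sphi cpt subOm].
have sub : closure [set x | 'D_v phi x != 0] `<=` closure [set x | phi x != 0].
  rewrite [X in _ `<=` X](closure_id _).1; last exact: closed_closure.
  apply: closureS => x /=; apply: contra_neqP => nx.
  rewrite (@near_eq_derive _ _ _ phi (cst 0)) ?derive_cst //.
  have := open_nbhs_nbhs (conj (closed_openC (@closed_closure _ [set x | phi x != 0])) nx).
  apply: filterS => y ny /=; apply/eqP; apply: contra_notT ny => phiy.
  exact: subset_closure.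
split.
(* The fold applies the last direction of the list first, so derivatives of 'D_v phi are those of
   [phi] along a list ending in [v]. *)
- by move=> vs x; have := sphi (rcons vs v) x; rewrite foldr_rcons.
- by apply: subclosed_compact cpt sub; exact: closed_closure.
- exact: subset_trans sub subOm.
Qed.

Lemma test_function_bounded phi : test_function Om phi ->
  exists B, forall x, `|phi x| <= B.
Proof.
move=> tphi; have [_ cpt _] := tphi.
have /compact_bounded[M [_ bM]] := continuous_compact
  (continuous_subspaceT (test_function_continuous tphi)) cpt.
exists (`|M| + 1) => x; have [->|phix] := eqVneq (phi x) 0.
  by rewrite normr0 addr_ge0.
apply: bM; first by rewrite ltr_pwDr // ler_norm.
by exists x => //; exact: subset_closure.
Qed.

(** The slices of [Om] may be arbitrary open sets, but [phi] vanishes off [Om], so the integral can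
    be taken over a box [I] x [J] in slab coordinates. Each line of direction v then contributes a
    full segment [-1, 1] with zero values at both ends. The direction may be oblique to the slab; n
    . v = 1 fixes the length of the parameter interval at 2. *)
Lemma poincare_slab (n1 n2 v1 v2 k : R) phi : bounded_set Om -> open Om ->
  n1 * v1 + n2 * v2 = 1 -> (forall x, Om x -> `|n1 * x.1 + n2 * x.2| < 1) ->
  0 <= k < pi / 2 -> test_function Om phi ->
  0 <= \int[leb2 R]_(x in Om) ('D_(v1, v2) phi x ^+ 2 - k ^+ 2 * phi x ^+ 2).
Proof.
move=> Om_bounded Om_open nv slab kpi tphi.
have mOm := open_measurable2 Om_open.
have tD := test_function_derive (v1, v2) tphi.
have cphi := test_function_continuous tphi.
have cD := test_function_continuous tD.
have det : - n2 * v2 - v1 * n1 != 0.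
  have -> : - n2 * v2 - v1 * n1 = - (n1 * v1 + n2 * v2) by ring.
  by rewrite nv oppr_eq0 oner_neq0.
(* [L] sends vertical lines to lines of direction [v], and [n . L (u, t) = t]. *)
have [c c0 cE] := integral_linmap det.
pose L : P2 R -> P2 R := linmap (- n2) v1 n1 v2.
pose G (x : P2 R) : R := 'D_(v1, v2) phi x ^+ 2 - k ^+ 2 * phi x ^+ 2.
have mG : measurable_fun setT G.
  apply: measurable_funB; first exact: (measurable_funX 2 (continuous_measurable2 cD)).
  by apply: measurable_funM => //; exact: (measurable_funX 2 (continuous_measurable2 cphi)).
have mGL : measurable_fun setT (G \o L).
  by apply: (measurableT_comp mG); exact: measurable_linmap.
have [B1 phiB] := test_function_bounded tphi.
have [B2 DB] := test_function_bounded tD.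
have GB x : `|G x| <= B2 ^+ 2 + k ^+ 2 * B1 ^+ 2.
  rewrite /G (le_trans (ler_normB _ _)) // lerD //.
    by rewrite normrX lerXn2r // nnegrE // (le_trans _ (DB x)).
  rewrite normrM ger0_norm ?sqr_ge0 // ler_wpM2l ?sqr_ge0 //.
  by rewrite normrX lerXn2r // nnegrE // (le_trans _ (phiB x)).
have [M M0 OM] := bounded_setP2 Om_bounded.
pose K : set (P2 R) := L @^-1` Om.
have mK : measurable K by exact: measurable_linmap_preimage.
pose N := (`|v1| + `|v2|) * M.
pose I : set (measurableTypeR R) := `[- N, N]%classic.
pose J : set (measurableTypeR R) := `[-1, 1]%classic.
have L2 u t : n1 * (L (u, t)).1 + n2 * (L (u, t)).2 = t.
  transitivity ((n1 * v1 + n2 * v2) * t); last by rewrite nv mul1r.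
  by rewrite /L /linmap /=; ring.
have L1 u t : v1 * (L (u, t)).2 - v2 * (L (u, t)).1 = u.
  transitivity ((n1 * v1 + n2 * v2) * u); last by rewrite nv mul1r.
  by rewrite /L /linmap /=; ring.
have KIJ : K `<=` I `*` J.
  move=> [u t] Kut; split => /=; rewrite /I /J /= in_itv /= -ler_norml.
    have [x1 x2] := OM _ Kut.
    rewrite -[u in `|u|](L1 u t) (le_trans (ler_normB _ _)) // !normrM /N mulrDl.
    by rewrite lerD // ler_wpM2l.
  by have := slab _ Kut; rewrite L2 => /ltW.
have mIJ : measurable (I `*` J) by apply: measurableX; exact: measurable_itv.
pose N1 := Num.max N 1.
have IJN z : (I `*` J) z -> `|z.1| <= N1 /\ `|z.2| <= N1.
  move=> [] /=; rewrite /I /J /= !in_itv /= -!ler_norml => z1 z2.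
  by split; rewrite /N1 le_max; [rewrite z1|rewrite z2 orbT].
rewrite (cE Om G mOm mG); last first.
  apply: (@integrable_bounded _ _ _ _ K (G \o L) (B2 ^+ 2 + k ^+ 2 * B1 ^+ 2)) => //.
  - by apply: (bounded_leb2_lty mK (M := N1)) => z /KIJ; exact: IJN.
  - exact: measurable_funTS.
  - by move=> z _; exact: GB.
apply: mulr_ge0; first exact: ltW.
have -> : \int[leb2 R]_(z in linmap (- n2) v1 n1 v2 @^-1` Om) G (linmap (- n2) v1 n1 v2 z) =
    \int[leb2 R]_(z in I `*` J) (G \o L) z.
  rewrite -/L -/K [LHS]Rintegral_mkcond [RHS]Rintegral_mkcond; congr Rintegral.
  apply/funext => z; rewrite !patchE; case: ifPn => [/set_mem Kz|/negP Kz].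
    by rewrite mem_set //; exact: KIJ.
  have Oz : ~ Om (L z) by move=> Oz; apply: Kz; exact: mem_set.
  case: ifP => // _; rewrite /= /G.
  by rewrite (test_function_eq0 tphi Oz) (test_function_eq0 tD Oz) !expr0n /= mulr0 subr0.
have [_ ->] := Rintegral_xsection mIJ IJN mGL (fun z _ => GB (L z)).
apply: Rintegral_ge0 => u _.
have [Iu|Iu] := boolP (u \in I); last by rewrite notin_xsectionX // Rintegral_set0.
rewrite in_xsectionX //.
apply: (@poincare_segment _ (fun t => phi (L (u, t))) (fun t => 'D_(v1, v2) phi (L (u, t)))) => //.
- move=> t.
  have LE h : L (u, h *: (1 : R) + t) = h *: (v1, v2) + L (u, t) :> R * R.
    transitivity (h * v1 + (- n2 * u + v1 * t), h * v2 + (n1 * u + v2 * t)); last by [].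
    by rewrite /L /linmap /GRing.scale /=; congr pair; ring.
  have fE : (fun h : R => h^-1 *: (((fun t => phi (L (u, t))) \o shift t) (h *: (1 : R)) - phi (L (u, t)))) =
      (fun h : R => h^-1 *: ((phi \o shift (L (u, t) : R * R)) (h *: (v1, v2)) - phi (L (u, t)))).
    by apply/funext => h /=; rewrite /shift /= LE.
  have dphi : derivable phi (L (u, t)) (v1, v2) by exact: (test_function_derivable tphi).
  by split; rewrite /derivable /derive fE.
- move=> t; apply: (continuous_comp (f := fun t => L (u, t)) (g := 'D_(v1, v2) phi)); last exact: cD.
  have cl (a b : R) : {for t, continuous (fun t : R => a + b * t)}.
    by apply: cvgD; [exact: cvg_cst|apply: cvgM; [exact: cvg_cst|exact: cvg_id]].
  exact: (cvg_pair (cl (- n2 * u) v1) (cl (n1 * u) v2)).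
(* The slab is open, so the points with n . x = -1 or 1 lie outside [Om]. *)
- by apply: (test_function_eq0 tphi) => /slab; rewrite L2 normrN normr1 ltxx.
- by apply: (test_function_eq0 tphi) => /slab; rewrite L2 normr1 ltxx.
Qed.

End TestFunction.

Section LinearCombination.
Context {d} {T : measurableType d} {R : realType}.
Variables (mu : {measure set T -> \bar R}) (A : set T).
Hypothesis mA : measurable A.
Implicit Types f g : T -> R.

Lemma integrable_lincomb f g (a b : R) : mu.-integrable A (EFin \o f) ->
  mu.-integrable A (EFin \o g) ->
  mu.-integrable A (EFin \o (fun x => a * f x + b * g x)).
Proof.
move=> intf intg; have := integrableD mA (integrableZl mA a intf) (integrableZl mA b intg).
exact: eq_integrable.
Qed.

Lemma Rintegral_lincomb f g (a b : R) : mu.-integrable A (EFin \o f) ->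
  mu.-integrable A (EFin \o g) ->
  \int[mu]_(x in A) (a * f x + b * g x) =
  a * \int[mu]_(x in A) f x + b * \int[mu]_(x in A) g x.
Proof.
move=> intf intg.
have ia : mu.-integrable A (EFin \o (fun x => a * f x)).
  by have := integrableZl mA a intf; exact: eq_integrable.
have ib : mu.-integrable A (EFin \o (fun x => b * g x)).
  by have := integrableZl mA b intg; exact: eq_integrable.
by rewrite (RintegralD mA ia ib) (RintegralZl _ mA intf) (RintegralZl _ mA intg).
Qed.

End LinearCombination.

Section SquareIntegrable.
Context {R : realType} (Om : set (R * R)).
Hypothesis Om_bounded : bounded_set Om.
Hypothesis Om_open : open Om.

Let mOm : measurable (Om : set (P2 R)).
Proof. exact: open_measurable2. Qed.

Let Om_oo : (leb2 R Om < +oo)%E.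
Proof. by have [M _ OM] := bounded_setP2 Om_bounded; exact: bounded_leb2_lty mOm OM. Qed.

Lemma square_integrableM (f g : P2 R -> R) :
  square_integrable Om f -> square_integrable Om g ->
  (leb2 R).-integrable Om (EFin \o (fun x => f x * g x)).
Proof.
move=> [mf f2] [mg g2]; have := integrable_lincomb mOm 1 1 f2 g2.
apply: (le_integrable mOm).
  by apply/measurable_EFinP; exact: measurable_funM.
move=> x _; rewrite /= lee_fin !mul1r normrM.
apply: le_trans (ler_norm _).
rewrite -(real_normK (num_real (f x))) -(real_normK (num_real (g x))).
have := normr_ge0 (f x); have := normr_ge0 (g x).
move: `|f x| `|g x| => a b a0 b0; nra.
Qed.

Lemma square_integrable_lincomb (f g : P2 R -> R) (a b : R) :
  square_integrable Om f -> square_integrable Om g ->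
  square_integrable Om (fun x => a * f x + b * g x).
Proof.
move=> sf sg; have [mf f2] := sf; have [mg g2] := sg; split.
  by apply: measurable_funD; exact: measurable_funM.
have fg := square_integrableM sf sg.
have := integrable_lincomb mOm 1 (b ^+ 2) (integrable_lincomb mOm (a ^+ 2) (2 * a * b) f2 fg) g2.
by apply: eq_integrable => // x _ /=; congr EFin; ring.
Qed.

Lemma test_function_square_integrable phi : test_function Om phi ->
  square_integrable Om phi.
Proof.
move=> tphi; have mphi := continuous_measurable2 (test_function_continuous tphi).
split; first exact: measurable_funTS.
have [B phiB] := test_function_bounded tphi.
apply: (integrable_bounded mOm Om_oo (M := B ^+ 2)).
  exact: (measurable_funTS (measurable_funX 2 mphi)).
by move=> x _; rewrite normrX lerXn2r // nnegrE // (le_trans _ (phiB x)).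
Qed.

(** [poincare_slab] stops short of the sharp constant, as tan blows up at pi / 2; the constant is
    recovered by taking k = s pi / 2 with s close to 1. *)
Lemma poincare_direction (n1 n2 v1 v2 : R) phi :
  n1 * v1 + n2 * v2 = 1 -> (forall x, Om x -> `|n1 * x.1 + n2 * x.2| < 1) ->
  test_function Om phi ->
  (pi / 2) ^+ 2 * \int[leb2 R]_(x in Om) (phi x ^+ 2) <=
  \int[leb2 R]_(x in Om) ('D_(v1, v2) phi x ^+ 2).
Proof.
move=> nv slab tphi; have pi0 := pi_gt0 R.
have [_ phi2] := test_function_square_integrable tphi.
have [_ D2] := test_function_square_integrable (test_function_derive (v1, v2) tphi).
have le_scaled (s : R) : 0 <= s < 1 ->
    s ^+ 2 * ((pi / 2) ^+ 2 * \int[leb2 R]_(x in Om) (phi x ^+ 2)) <=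
    \int[leb2 R]_(x in Om) ('D_(v1, v2) phi x ^+ 2).
  move=> /andP[s0 s1]; have kpi : 0 <= s * (pi / 2) < pi / 2.
    have k0 : 0 < pi / 2 :> R by rewrite divr_gt0.
    by rewrite mulr_ge0 ?(ltW k0) // -[ltRHS]mul1r ltr_pM2r.
  have := poincare_slab Om_bounded Om_open nv slab kpi tphi.
  rewrite (@eq_Rintegral _ _ _ (leb2 R) _ (fun x => 1 * 'D_(v1, v2) phi x ^+ 2 +
    - (s * (pi / 2)) ^+ 2 * phi x ^+ 2)); last by move=> x _; rewrite mul1r mulNr.
  by rewrite (Rintegral_lincomb mOm _ _ D2 phi2) mul1r mulNr exprMn mulrA subr_ge0.
move: le_scaled; set a := _ ^+ 2 * _; set b := \int[_]_(_ in _) _ => le_scaled.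
have b0 : 0 <= b by have := le_scaled 0; rewrite lexx ltr01 expr0n /= mul0r; apply.
rewrite leNgt; apply/negP => ba; have a0 : 0 < a by exact: le_lt_trans ba.
(* For r = b / a < 1 the mean s = (1 + r) / 2 satisfies s^2 > r, which contradicts s^2 a <= b. *)
have := le_scaled ((1 + b / a) / 2).
have r0 : 0 <= b / a by rewrite divr_ge0 // ltW.
have r1 : b / a < 1 by rewrite ltr_pdivrMr // mul1r.
have -> : b = (b / a) * a by rewrite mulfVK // gt_eqF.
move: r0 r1; set r := b / a => r0 r1.
have -> : 0 <= (1 + r * a / a) / 2 < 1 by rewrite mulfK ?gt_eqF //; apply/andP; split; lra.
rewrite mulfK ?gt_eqF // ler_pM2r // => /(_ isT).
by apply/negP; rewrite -ltNge; nra.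
Qed.

Lemma poincare_frame (c s p q m : R) phi :
  c ^+ 2 + s ^+ 2 = 1 -> 0 < p -> 0 < q ->
  (forall z, Om z ->
     `|p * (c * z.1 + s * z.2) - m * (q * (c * z.2 - s * z.1))| < 1 /\
     `|q * (c * z.2 - s * z.1) + m * (p * (c * z.1 + s * z.2))| < 1) ->
  test_function Om phi ->
  (pi / 2) ^+ 2 * (p ^+ 2 + q ^+ 2) * \int[leb2 R]_(x in Om) (phi x ^+ 2) <=
  \int[leb2 R]_(x in Om) ('D_(1, 0) phi x ^+ 2 + 'D_(0, 1) phi x ^+ 2).
Proof.
move=> cs p0 q0 strips tphi.
have p_neq0 : p != 0 by rewrite gt_eqF.
have q_neq0 : q != 0 by rewrite gt_eqF.
have DE (v1 v2 : R) x : 'D_(v1, v2) phi x = v1 * 'D_(1, 0) phi x + v2 * 'D_(0, 1) phi x.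
  have [/(_ [::] x) /= dphi _ _] := tphi.
  have -> : (v1, v2) = v1 *: ((1, 0) : R * R) + v2 *: ((0, 1) : R * R).
    transitivity (v1 * 1 + v2 * 0, v1 * 0 + v2 * 1); last by [].
    by rewrite !mulr0 !mulr1 addr0 add0r.
  by rewrite !deriveE // linearD !linearZ.
have sD v := test_function_square_integrable (test_function_derive v tphi).
have h1 : (pi / 2) ^+ 2 * \int[leb2 R]_(x in Om) (phi x ^+ 2) <=
    \int[leb2 R]_(x in Om) ('D_(c / p, s / p) phi x ^+ 2).
  (* The normal p e1 - m q e2 of the strip pairs to 1 with e1 / p, since its tilt is along e2. *)
  apply: (@poincare_direction (p * c + m * q * s) (p * s - m * q * c)) => //.
    by rewrite -cs; field.
  move=> z /strips[+ _]; congr (`|_| < 1); ring.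
have h2 : (pi / 2) ^+ 2 * \int[leb2 R]_(x in Om) (phi x ^+ 2) <=
    \int[leb2 R]_(x in Om) ('D_(- s / q, c / q) phi x ^+ 2).
  apply: (@poincare_direction (m * p * c - q * s) (m * p * s + q * c)) => //.
    by rewrite -cs; field.
  move=> z /strips[_]; congr (`|_| < 1); ring.
have -> : \int[leb2 R]_(x in Om) ('D_(1, 0) phi x ^+ 2 + 'D_(0, 1) phi x ^+ 2) =
    p ^+ 2 * \int[leb2 R]_(x in Om) ('D_(c / p, s / p) phi x ^+ 2) +
    q ^+ 2 * \int[leb2 R]_(x in Om) ('D_(- s / q, c / q) phi x ^+ 2).
  rewrite -(Rintegral_lincomb mOm _ _ (sD (c / p, s / p)).2 (sD (- s / q, c / q)).2).
  apply: eq_Rintegral => x _; rewrite (DE (c / p)) (DE (- s / q)).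
  move: ('D_(1, 0) phi x) ('D_(0, 1) phi x) => d1 d2.
  by rewrite -[LHS]mul1r -cs; field; rewrite p_neq0 q_neq0.
apply: le_trans (lerD (ler_wpM2l (sqr_ge0 p) h1) (ler_wpM2l (sqr_ge0 q) h2)).
by move: (\int[_]_(_ in _) _) => I; rewrite le_eqVlt; apply/orP; left; apply/eqP; ring.
Qed.

End SquareIntegrable.

(** * Dirichlet eigenvalues *)

(* Used with [(a, b)] the gradient of a test function [f], and [(a', b')] the
   weak gradient of the eigenfunction [v]. *)
Lemma young_pointwise {R : realFieldType} (e l a b f v a' b' : R) : 0 < e ->
  (1 - e / 2) * (a ^+ 2 + b ^+ 2) + - (l + `|l| * e / 2) * f ^+ 2 <=
  a' * a + b' * b + - l * (v * f) +
  (1 + `|l|) / (2 * e) * ((f - v) ^+ 2 + (a - a') ^+ 2 + (b - b') ^+ 2).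
Proof.
move=> e0; pose r := (2 * e)^-1.
have r0 : 0 < r by rewrite invr_gt0 mulr_gt0.
have er : e * r = 1 / 2 by rewrite /r; field; rewrite gt_eqF.
(* The slack in Young's inequality x h <= (e / 2) x^2 + h^2 / (2 e). The difference of the two sides
   of the claim is a nonnegative combination of such slacks and of squares; the sign of [l] decides
   whether v - f or f - v enters. *)
pose Y x h := e / 2 * x ^+ 2 - x * h + r * h ^+ 2.
have Y0 x h : 0 <= Y x h.
  have -> : Y x h = e / 2 * (x - 2 * r * h) ^+ 2.
    have -> : e / 2 * (x - 2 * r * h) ^+ 2 = e / 2 * x ^+ 2 - 2 * (e * r) * (x * h) + 2 * (e * r) * r * h ^+ 2 by field.
    by rewrite er /Y; field.
  by rewrite mulr_ge0 ?sqr_ge0 // divr_ge0 // ltW.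
have sum_ge0 k x1 h1 x2 h2 x3 h3 y1 y2 y3 : 0 <= k ->
    0 <= Y x1 h1 + Y x2 h2 + k * Y x3 h3 + k * r * (y1 ^+ 2 + y2 ^+ 2) + r * y3 ^+ 2.
  move=> k0; rewrite addr_ge0 //; last by rewrite mulr_ge0 ?sqr_ge0 // ltW.
  rewrite addr_ge0 //; last by rewrite !mulr_ge0 ?addr_ge0 ?sqr_ge0 // ltW.
  exact: addr_ge0 (addr_ge0 (Y0 _ _) (Y0 _ _)) (mulr_ge0 k0 (Y0 _ _)).
rewrite -/r -subr_ge0.
have [l0|l0] := ger0P l.
  rewrite (_ : _ - _ = Y a (a - a') + Y b (b - b') + l * Y f (v - f) +
    l * r * ((a - a') ^+ 2 + (b - b') ^+ 2) + r * (f - v) ^+ 2); last by rewrite /Y; field.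
  exact: sum_ge0.
rewrite (_ : _ - _ = Y a (a - a') + Y b (b - b') + - l * Y f (f - v) +
  - l * r * ((a - a') ^+ 2 + (b - b') ^+ 2) + r * (f - v) ^+ 2); last by rewrite /Y; field.
by apply: sum_ge0; rewrite oppr_ge0 ltW.
Qed.

(* If [l < C], the equation tested with the approximations [phi n] of the
   eigenfunction [u] bounds the integral of [phi n ^+ 2] by the H^1 distance from
   [phi n] to [u], whence [u = 0]. *)
Lemma eigenvalue_ge {R : realType} (Om : set (R * R)) (C l : R) :
  bounded_set Om -> open Om -> 0 <= C ->
  (forall phi, test_function Om phi ->
    C * \int[leb2 R]_(x in Om) (phi x ^+ 2) <=
    \int[leb2 R]_(x in Om) ('D_(1, 0) phi x ^+ 2 + 'D_(0, 1) phi x ^+ 2)) ->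
  dirichlet_eigenvalue Om l -> C <= l.
Proof.
move=> Om_bounded Om_open C0 poincare [u [g1 [g2 [[[su [sg1 sg2] _ _] [phi tphi cvg_phi]] u_neq0 eigen]]]].
have mOm := open_measurable2 Om_open.
rewrite leNgt; apply/negP => lC; apply: u_neq0.
have [mu u2] := su.
have l_le := ler_norm (- l); rewrite normrN in l_le.
have Cl0 : 0 < C + `|l| by lra.
(* With this [e] the coefficient (1 - e / 2) C - (l + |l| e / 2), left once the Poincare bound is
   inserted in [young], is exactly (C - l) / 2. *)
pose e := (C - l) / (C + `|l|).
have e0 : 0 < e by rewrite divr_gt0 // subr_gt0.
have e1 : e <= 1 by rewrite ler_pdivrMr // mul1r lerD2l.
have eE : e * (C + `|l|) = C - l by rewrite mulfVK // gt_eqF.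
pose K := (1 + `|l|) / (2 * e).
pose A n x := (phi n x - u x) ^+ 2 + ('D_(1, 0) (phi n) x - g1 x) ^+ 2 + ('D_(0, 1) (phi n) x - g2 x) ^+ 2.
have sphi n : square_integrable Om (phi n) by exact: test_function_square_integrable.
have sD n v : square_integrable Om ('D_v (phi n)).
  exact/test_function_square_integrable/test_function_derive.
have sB (f g : P2 R -> R) : square_integrable Om f -> square_integrable Om g ->
    (leb2 R).-integrable Om (EFin \o (fun x => (f x - g x) ^+ 2)).
  move=> sf sg; have [_] := square_integrable_lincomb Om_open 1 (-1) sf sg.
  by apply: eq_integrable => // x _ /=; rewrite mul1r mulN1r.
have add (f g : P2 R -> R) : (leb2 R).-integrable Om (EFin \o f) ->
    (leb2 R).-integrable Om (EFin \o g) -> (leb2 R).-integrable Om (EFin \o (fun x => f x + g x)).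
  move=> intf intg; have := integrable_lincomb mOm 1 1 intf intg.
  by apply: eq_integrable => // x _ /=; rewrite !mul1r.
have iA n : (leb2 R).-integrable Om (EFin \o A n).
  exact: add (add _ _ (sB _ _ (sphi n) su) (sB _ _ (sD n (1, 0)) sg1)) (sB _ _ (sD n (0, 1)) sg2).
pose E n x := g1 x * 'D_(1, 0) (phi n) x + g2 x * 'D_(0, 1) (phi n) x.
have iE n : (leb2 R).-integrable Om (EFin \o E n).
  exact: add (square_integrableM Om_open sg1 (sD n (1, 0))) (square_integrableM Om_open sg2 (sD n (0, 1))).
pose G n x := 'D_(1, 0) (phi n) x ^+ 2 + 'D_(0, 1) (phi n) x ^+ 2.
have iG n : (leb2 R).-integrable Om (EFin \o G n).
  exact: add (sD n (1, 0)).2 (sD n (0, 1)).2.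
have iF n := square_integrableM Om_open su (sphi n).
have iphi n := (sphi n).2.
have young n : (1 - e / 2) * \int[leb2 R]_(x in Om) G n x +
    - (l + `|l| * e / 2) * \int[leb2 R]_(x in Om) (phi n x ^+ 2) <=
    K * \int[leb2 R]_(x in Om) A n x.
  have -> : K * \int[leb2 R]_(x in Om) A n x =
      1 * (1 * \int[leb2 R]_(x in Om) E n x + - l * \int[leb2 R]_(x in Om) (u x * phi n x)) +
      K * \int[leb2 R]_(x in Om) A n x.
    by rewrite (eigen _ (tphi n)) !mul1r mulNr subrr add0r.
  rewrite -(Rintegral_lincomb mOm _ _ (iG n) (iphi n)) -(Rintegral_lincomb mOm _ _ (iE n) (iF n)).
  rewrite -(Rintegral_lincomb mOm _ _ (integrable_lincomb mOm _ _ (iE n) (iF n)) (iA n)).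
  apply: (le_Rintegral mOm).
  - exact: integrable_lincomb.
  - exact: integrable_lincomb (integrable_lincomb mOm _ _ (iE n) (iF n)) (iA n).
  move=> x _; rewrite /G /E /A !mul1r.
  move: ('D_(1, 0) (phi n) x) ('D_(0, 1) (phi n) x) (phi n x) (u x) (g1 x) (g2 x) => a b f v a' b'.
  exact: young_pointwise.
(* The constant combines u^2 <= 2 phi^2 + 2 (phi - u)^2 with the bound 2 K / (C - l) on the ratio of
   the integrals of phi^2 and [A n]. *)
have bound n : \int[leb2 R]_(x in Om) (u x ^+ 2) <= (4 * K / (C - l) + 2) * \int[leb2 R]_(x in Om) A n x.
  have h1 : (C - l) / 2 * \int[leb2 R]_(x in Om) (phi n x ^+ 2) <= K * \int[leb2 R]_(x in Om) A n x.
    apply: le_trans (young n).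
    have := poincare _ (tphi n).
    rewrite -/(G n).
    move: (\int[_]_(_ in _) G n _) (\int[_]_(_ in _) (phi n _ ^+ 2)) => Y X CXY.
    have e2 : 0 <= 1 - e / 2 by lra.
    apply: (@le_trans _ _ ((1 - e / 2) * (C * X) + - (l + `|l| * e / 2) * X)).
      rewrite [leRHS](_ : _ = (C - l) * X - (e * (C + `|l|)) / 2 * X); last by field.
      by rewrite eE le_eqVlt; apply/orP; left; apply/eqP; field.
    by rewrite lerD2r ler_wpM2l.
  have h2 : \int[leb2 R]_(x in Om) (u x ^+ 2) <=
      2 * \int[leb2 R]_(x in Om) (phi n x ^+ 2) + 2 * \int[leb2 R]_(x in Om) A n x.
    rewrite -(Rintegral_lincomb mOm _ _ (iphi n) (iA n)).
    apply: (le_Rintegral mOm u2 (integrable_lincomb mOm _ _ (iphi n) (iA n))) => x _.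
    rewrite /A; move: (phi n x) (u x) => a b.
    have := sqr_ge0 ('D_(1, 0) (phi n) x - g1 x); have := sqr_ge0 ('D_(0, 1) (phi n) x - g2 x).
    move: (('D_(1, 0) (phi n) x - g1 x) ^+ 2) (('D_(0, 1) (phi n) x - g2 x) ^+ 2) => y z.
    have := sqr_ge0 (2 * a - b); nra.
  apply: le_trans h2 _; rewrite [leRHS]mulrDl lerD2r.
  have Cl : 0 < C - l by rewrite subr_gt0.
  move: h1; move: (\int[_]_(_ in _) A n _) (\int[_]_(_ in _) (phi n _ ^+ 2)) => Y X.
  rewrite -ler_pdivlMl ?divr_gt0 // => h1.
  rewrite (_ : 4 * K / (C - l) * Y = 2 * (((C - l) / 2)^-1 * (K * Y))); last first.
    by field; rewrite gt_eqF.
  by rewrite ler_pM2l.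
have K0 : 0 < 4 * K / (C - l) + 2.
  rewrite ltr_wpDl // divr_ge0 ?subr_ge0 ?(ltW lC) // mulr_ge0 //.
  by rewrite divr_ge0 ?addr_ge0 // mulr_ge0 // ltW.
have U0 : \int[leb2 R]_(x in Om) (u x ^+ 2) <= 0.
  rewrite leNgt; apply/negP => U0.
  have d0 : 0 < \int[leb2 R]_(x in Om) (u x ^+ 2) / (4 * K / (C - l) + 2) by rewrite divr_gt0.
  move/cvgrPdist_lt : cvg_phi => /(_ _ d0) [N _ /(_ N (leqnn N))].
  rewrite /= sub0r normrN => hN.
  have := lt_le_trans (le_lt_trans (ler_norm _) hN) (le_refl _).
  by rewrite ltr_pdivlMr // mulrC ltNge (bound N).
have U0e : (\int[leb2 R]_(x in Om) `|(u x ^+ 2)%:E| = 0)%E.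
  have -> : (\int[leb2 R]_(x in Om) `|(u x ^+ 2)%:E|)%E = (\int[leb2 R]_(x in Om) (u x ^+ 2))%:E.
    rewrite /Rintegral fineK; last exact: integrable_fin_num.
    by apply: eq_integral => x _; rewrite gee0_abs // lee_fin sqr_ge0.
  congr EFin; apply/eqP; rewrite eq_le U0 /=.
  by apply: Rintegral_ge0 => x _; exact: sqr_ge0.
have := (ae_eq_integral_abs (leb2 R) mOm (f := EFin \o (fun x => u x ^+ 2)) ltac:(exact: measurable_int u2)).1 U0e.
apply: filterS => x /= h Ox; have := h Ox; case => /eqP.
by rewrite sqrf_eq0 => /eqP.
Qed.

Theorem theorem2p5 (R : realType) (Omega : set (R * R))
    (Omega_bounded : bounded_set Omega) (Omega_open : open Omega)
    (Omega_convex : convex_set Omega) (Omega_balanced : balanced Omega) :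
  (kappa Omega <= 2%:E * sqrte (lambda1 Omega))%E.
Proof.
(* The gauge requires a point of [Omega]. On the empty set every [u] vanishes almost everywhere, so
   there is no eigenvalue and the right-hand side is +oo. *)
have [Om0 | /set0P Om_neq0] := eqVneq Omega set0.
  have -> : lambda1 Omega = +oo%E.
    rewrite /lambda1 (_ : dirichlet_eigenvalue Omega = set0) ?image_set0 ?ereal_inf0 //.
    apply/seteqP; split => // l [u [g1 [g2 [_ + _]]]]; apply.
    by apply: aeW => x; rewrite Om0.
  by rewrite /= gt0_muley ?leey // lte_fin.
have [c [s [p [q [m [[cs p0 q0 m1] [square strips]]]]]]] :=
  conjugate_frame Omega_bounded Omega_open Omega_convex Omega_balanced Om_neq0.
have pi0 := pi_gt0 R.
(* [C] is T^2 / 4, so that 2 sqrt C is the bound T on kappa. *)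
set C := (pi / 2) ^+ 2 * (p ^+ 2 + q ^+ 2) : R.
have C0 : 0 <= C by rewrite mulr_ge0 ?addr_ge0 ?sqr_ge0.
have lambda_ge : (C%:E <= lambda1 Omega)%E.
  apply: le_ereal_inf_tmp => _ [l eigen_l <-]; rewrite lee_fin.
  apply: eigenvalue_ge eigen_l => // phi.
  exact: (poincare_frame Omega_bounded Omega_open cs p0 q0 strips).
apply: le_trans (kappa_le_frame Omega_bounded Omega_open Omega_balanced Omega_convex cs p0 q0 m1 square strips) _.
have -> : (pi * Num.sqrt (p ^+ 2 + q ^+ 2))%:E = (2%:E * sqrte C%:E)%E.
  rewrite /= -EFinM; congr EFin.
  rewrite /C sqrtrM ?sqr_ge0 // sqrtr_sqr ger0_norm ?divr_ge0 ?(ltW pi0) //.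
  by rewrite mulrA; congr (_ * _); field.
rewrite lee_pmul2l // lee_sqrt //; apply: le_trans lambda_ge.
by rewrite lee_fin.
Qed.
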